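(* Let $0<\alpha<1$ and $\lambda\ge1$, and consider the bilinear estimates $$\text{(i)}\quad\|\partial_x(uv)\|_{X^{s,b-1}_\alpha(\mathbb{T}_\lambda\times\mathbb{R})}\lesssim\|u\|_{X^{s,b}(\mathbb{T}_\lambda\times\mathbb{R})}\|v\|_{X^{s,b}_\alpha(\mathbb{T}_\lambda\times\mathbb{R})},$$ $$\text{(ii)}\quad\|\partial_x(uv)\|_{Z^s_\alpha(\mathbb{T}_\lambda\times\mathbb{R})}\lesssim\|u\|_{Y^s(\mathbb{T}_\lambda\times\mathbb{R})}\|v\|_{Y^s_\alpha(\mathbb{T}_\lambda\times\mathbb{R})}.$$ (a) Without the mean $0$ condition on $u$, estimate (i) fails for any $s,b\in\mathbb{R}$ (and hence (ii) fails for any $s\in\mathbb{R}$). (b) If $s<\min(1,\frac12+\frac12\max(\nu_{d_1},\nu_{d_2}))$, then (i) fails for any $b\in\mathbb{R}$ (and hence (ii) fails), even when restricted to $u$ with mean $0$.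
   Context: $\mathbb{T}_\lambda=[0,2\pi\lambda)$ (periodic); $\langle\cdot\rangle=1+|\cdot|$. The spatial Fourier variable is $\xi\in\mathbb{Z}/\lambda$; $\widehat{\ }$ denotes the space-time Fourier transform; norms in $\xi$ use the measure $\frac1{2\pi\lambda}\times$ counting measure on $\mathbb{Z}/\lambda$. Mean $0$ means $\widehat u(0,\tau)=0$ for almost every $\tau$. An estimate fails if, for the given parameters, there is no finite constant for which it holds for all admissible $u,v$ in the indicated spaces. $\|u\|_{X^{s,b}}=\|\langle\xi\rangle^s\langle\tau-\xi^3\rangle^b\widehat u\|_{L^2_{\xi,\tau}}$, $\|v\|_{X^{s,b}_\alpha}=\|\langle\xi\rangle^s\langle\tau-\alpha\xi^3\rangle^b\widehat v\|_{L^2_{\xi,\tau}}$, $\|u\|_{Y^s}=\|u\|_{X^{s,1/2}}+\|\langle\xi\rangle^s\widehat u\|_{L^2_\xi L^1_\tau}$, $\|v\|_{Y^s_\alpha}=\|v\|_{X^{s,1/2}_\alpha}+\|\langle\xi\rangle^s\widehat v\|_{L^2_\xi L^1_\tau}$, $\|v\|_{Z^s_\alpha}=\|v\|_{X^{s,-1/2}_\alpha}+\|\langle\xi\rangle^s\langle\tau-\alpha\xi^3\rangle^{-1}\widehat v\|_{L^2_\xi L^1_\tau}$. $d_1=\frac{-3\alpha+\sqrt{3\alpha(4-\alpha)}}{2(1-\alpha)}$, $d_2=\frac{-3\alpha-\sqrt{3\alpha(4-\alpha)}}{2(1-\alpha)}$. A real number $\rho$ is of type $\nu>0$ if there is $K>0$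 such that $|\rho-\frac mn|\ge K|n|^{-2-\nu}$ for all pairs of integers $(m,n)$, $n\ne0$; $\nu_\rho=\infty$ if $\rho\in\mathbb{Q}$, and $\nu_\rho=\inf\{\nu>0:\rho\text{ is of type }\nu\}$ (with $\inf\emptyset=\infty$) if $\rho\notin\mathbb{Q}$. *)

(* Defs.v *)
From mathcomp Require Import all_boot all_order all_algebra.
From mathcomp Require Import all_classical all_reals all_analysis.
From mathcomp Require Import complex.

Set Implicit Arguments.
Unset Strict Implicit.
Unset Printing Implicit Defensive.

Import Order.TTheory GRing.Theory Num.Theory.
Import numFieldNormedType.Exports.

Local Open Scope classical_set_scope.
Local Open Scope ring_scope.
Local Open Scope complex_scope.

Section FunctionsOnTorusTimesLine.
Context {R : realType}.

(* A complex function of (x, t) on T_lambda x R is given by its lift to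
   R x R, which is (2 pi lambda)-periodic in x. *)
Implicit Types (u v : R -> R -> R[i]) (lambda : R).

(* R[i] carries no R-normed-module structure here, so derivatives and integrals
   of R[i]-valued functions are taken componentwise. *)
Definition partial_x u : R -> R -> R[i] := fun x t =>
  derive1 (fun y => complex.Re (u y t)) x +i*
  derive1 (fun y => complex.Im (u y t)) x.

Definition partial_t u : R -> R -> R[i] := fun x t =>
  derive1 (fun y => complex.Re (u x y)) t +i*
  derive1 (fun y => complex.Im (u x y)) t.

Definition has_partials u : Prop := forall x t,
  [/\ derivable (fun y => complex.Re (u y t)) x 1,
      derivable (fun y => complex.Im (u y t)) x 1,
      derivable (fun y => complex.Re (u x y)) t 1 &
      derivable (fun y => complex.Im (u x y)) t 1].

Definition jointly_continuous u : Prop :=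
  continuous (fun p : R * R => complex.Re (u p.1 p.2)) /\
  continuous (fun p : R * R => complex.Im (u p.1 p.2)).

Definition rapidly_decreasing_in_t u : Prop :=
  forall m : nat, exists M : R, forall x t,
    `|t| ^+ m * ComplexField.Normc.normc (u x t) <= M.

(* The Schwartz functions on T_lambda x R. They lie in all the spaces below,
   and the estimates are tested on them: for such u and v the product u v and
   its x-derivative are the classical ones, and an estimate that fails on
   Schwartz functions fails on every larger class of admissible functions. *)
Definition schwartz lambda : set (R -> R -> R[i]) := [set u |
  (forall x t, u (x + 2 * pi * lambda) t = u x t) /\
  forall j k : nat, let w := iter j partial_x (iter k partial_t u) in
    [/\ jointly_continuous w, has_partials w & rapidly_decreasing_in_t w]].

Definition Cintegral (D : set R) (f : R -> R[i]) : R[i] :=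
  (\int[lebesgue_measure]_(y in D) complex.Re (f y)) +i*
  (\int[lebesgue_measure]_(y in D) complex.Im (f y)).

Definition expi (theta : R) : R[i] := cos theta +i* sin theta.

Definition freq lambda (k : int) : R := k%:~R / lambda.

(* \hat u (xi, tau) for xi = freq lambda k, so that k ranges over int when xi
   ranges over Z / lambda. *)
Definition fourier lambda u (k : int) (tau : R) : R[i] :=
  Cintegral `[0, 2 * pi * lambda[ (fun x =>
    Cintegral setT (fun t => expi (- (x * freq lambda k + t * tau)) * u x t)).

Definition mean0 lambda : set (R -> R -> R[i]) := [set u |
  {ae (@lebesgue_measure R), forall tau : R, fourier lambda u 0 tau = 0}].

Definition bracket (y : R) : R := 1 + `|y|.

Definition modulation lambda alpha (k : int) (tau : R) : R :=
  bracket (tau - alpha * freq lambda k ^+ 3).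

(* The L^2 norm over Z / lambda with 1 / (2 pi lambda) times the counting
   measure. *)
Definition L2xi lambda (F : int -> \bar R) : \bar R :=
  ((((2 * pi * lambda)^-1)%:E * \esum_(k in [set: int]) (F k `^ 2)) `^ 2^-1)%E.

Definition L2tau (f : R -> R[i]) : \bar R :=
  ((\int[lebesgue_measure]_tau (ComplexField.Normc.normc (f tau) ^+ 2)%:E)
     `^ 2^-1)%E.

Definition L1tau (f : R -> R[i]) : \bar R :=
  (\int[lebesgue_measure]_tau (ComplexField.Normc.normc (f tau))%:E)%E.

(* The norms of the spaces with subscript alpha; those without subscript are
   the case alpha = 1. *)
Definition Xnorm lambda alpha s b u : \bar R :=
  L2xi lambda (fun k => L2tau (fun tau =>
    (bracket (freq lambda k) `^ s * modulation lambda alpha k tau `^ b)%:C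
      * fourier lambda u k tau)).

Definition Ynorm lambda alpha s u : \bar R :=
  (Xnorm lambda alpha s 2^-1 u +
   L2xi lambda (fun k => L1tau (fun tau =>
     ((bracket (freq lambda k) `^ s)%:C * fourier lambda u k tau)%R)))%E.

Definition Znorm lambda alpha s u : \bar R :=
  (Xnorm lambda alpha s (- 2^-1) u +
   L2xi lambda (fun k => L1tau (fun tau =>
     ((bracket (freq lambda k) `^ s * (modulation lambda alpha k tau)^-1)%:C
       * fourier lambda u k tau)%R)))%E.

(* Estimates (i) and (ii) for u in U; v is unrestricted. *)
Definition X_estimate lambda alpha s b (U : set (R -> R -> R[i])) : Prop :=
  exists C : R, forall u v, schwartz lambda u -> schwartz lambda v -> U u ->
    (Xnorm lambda alpha s (b - 1) (partial_x (fun x t => (u x t * v x t)%R)) <=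
     C%:E * (Xnorm lambda 1 s b u * Xnorm lambda alpha s b v))%E.

Definition YZ_estimate lambda alpha s (U : set (R -> R -> R[i])) : Prop :=
  exists C : R, forall u v, schwartz lambda u -> schwartz lambda v -> U u ->
    (Znorm lambda alpha s (partial_x (fun x t => (u x t * v x t)%R)) <=
     C%:E * (Ynorm lambda 1 s u * Ynorm lambda alpha s v))%E.

End FunctionsOnTorusTimesLine.

Section DiophantineType.
Context {R : realType}.
Implicit Types rho nu alpha : R.

Definition of_type rho nu : Prop :=
  exists2 K : R, 0 < K &
    forall m n : int, n != 0 ->
      K * `|n%:~R : R| `^ (- 2 - nu) <= `|rho - m%:~R / n%:~R|.

Definition type_index rho : \bar R :=
  if rho \in (@rational R) then +oo%E
  else ereal_inf [set nu%:E | nu in [set nu | 0 < nu /\ of_type rho nu]].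

Definition d1 alpha : R :=
  (- 3 * alpha + Num.sqrt (3 * alpha * (4 - alpha))) / (2 * (1 - alpha)).

Definition d2 alpha : R :=
  (- 3 * alpha - Num.sqrt (3 * alpha * (4 - alpha))) / (2 * (1 - alpha)).

End DiophantineType.

(* Main.v *)
Require Import Defs.
From mathcomp Require Import all_boot all_order all_algebra.
From mathcomp Require Import all_classical all_reals all_analysis.
From mathcomp Require Import measurable_realfun complex ring lra zify.

Set Implicit Arguments.
Unset Strict Implicit.
Unset Printing Implicit Defensive.

Import Order.TTheory GRing.Theory Num.Theory.
Import numFieldNormedType.Exports.

Local Open Scope classical_set_scope.
Local Open Scope ring_scope.

(** The estimates are tested on Gaussian wave packets
      u = e^{i (x xi1 + t sigma1)} e^{- t^2},
      v = e^{i (x xi2 + t sigma2)} e^{- t^2},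
    each carried by a single spatial frequency.  The product is a wave packet
    of frequency xi = xi1 + xi2 with profile e^{- 2 t^2}, and the x-derivative
    multiplies it by i xi.  In time, the Fourier transforms of u, v and the
    product are Gaussians centred at sigma1, sigma2 or sigma1 + sigma2
    ([Rintegral_trig_gaussian], [fourier_wave]); since
    <x + y>^b <= <x>^b <y>^|b| ([peetre]), a weight <tau - x>^b acts on such a
    Gaussian like its value at the centre.  Hence both estimates imply, with
    b = 1/2 for the second one, the numerical inequality ([wave_estimate])
      |xi| <xi>^s <sigma1 + sigma2 - alpha xi^3>^(b-1)
        <= C <xi1>^s <sigma1 - xi1^3>^b <xi2>^s <sigma2 - alpha xi2^3>^b
    for all frequencies and all sigma1, sigma2.

    Without the mean zero condition xi1 = 0 is allowed.  With sigma1 = 0 and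
    sigma2 = alpha xi2^3 all modulations vanish, xi = xi2, and the inequality
    says |xi| <= C for all xi ([not_wave_estimate_setT]).

    With mean zero, let H = xi1^3 + alpha xi2^3 - alpha xi^3.  The choice
    sigma1 = xi1^3, sigma2 = alpha xi2^3 puts the modulation H on the product;
    replacing sigma1 by xi1^3 - H puts it on u.  Multiplying the two resulting
    inequalities makes b disappear ([wave_estimate_resonance]):
      (|xi| <xi>^s)^2 <= C^2 (<xi1>^s <xi2>^s)^2 <H>.
    Moreover H = (1 - alpha) xi1 (xi1 - d1 xi) (xi1 - d2 xi)
    ([resonance_factor]), so H is small when xi1 / xi is close to a root d.
    If |d - m / n| <= |n|^(-2-beta) with n arbitrarily large, take
    xi1 = m / lambda, xi = n / lambda: then xi1 and xi2 are comparable to xi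
    because d is neither 0 nor 1, and H is of size at most |xi|^(1-beta), so
    that 2 - 2s <= 1 - beta ([not_wave_estimate_approximable]).

    It remains to find such approximations for some beta in [0, 1] with
    beta > 2s - 1 ([approximable_type_index]).  If d is rational, d = m / n has
    solutions with n as large as desired, and beta = 1 works.  If d is
    irrational and s < 1/2, beta = 0 works by the theorem of Dirichlet.
    Otherwise choose beta > 2s - 1 below the type index of d and at most 1;
    then d is not of type beta, which says that such approximations exist. *)

Lemma eq_ler (R : numDomainType) (x y : R) : x = y -> x <= y.
Proof. by move=> ->. Qed.

(** * Gaussians and integration on the line *)

Section Gaussian.
Context {R : realType}.
Implicit Types (a b c d m s t tau : R).
Local Notation mu := (@lebesgue_measure R).

Definition gaussian a t : R := expR (- (a * t ^+ 2)).

Definition gaussian_mass a : R := Num.sqrt (pi / a).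

Lemma gaussian_gt0 a t : 0 < gaussian a t.
Proof. exact: expR_gt0. Qed.

Lemma gaussian_mass_gt0 a : 0 < a -> 0 < gaussian_mass a.
Proof. by move=> a0; rewrite sqrtr_gt0 divr_gt0// pi_gt0. Qed.

(** Identifying the Gaussian with a multiple of a normal density gives its
    integrability and its mass, whatever its centre. *)
Lemma gaussian_normal_pdf a m t : 0 < a ->
  gaussian a (t - m) = gaussian_mass a * normal_pdf m (Num.sqrt (2 * a))^-1 t.
Proof.
move=> a0; have a20 : 0 < 2 * a by rewrite mulr_gt0.
have s0 : (Num.sqrt (2 * a))^-1 != 0 by rewrite invr_neq0// sqrtr_eq0 -ltNge.
have sE : (Num.sqrt (2 * a))^-1 ^+ 2 = (2 * a)^-1.
  by rewrite exprVn sqr_sqrtr// ltW.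
rewrite normal_pdfE// /normal_peak /normal_fun sE.
rewrite (_ : (2 * a)^-1 * pi *+ 2 = pi / a); last by field; lra.
rewrite mulrA divff ?gt_eqF ?gaussian_mass_gt0// mul1r; congr expR.
by field; lra.
Qed.

Lemma continuous_gaussian a : continuous (gaussian a).
Proof.
move=> t; apply: (@continuous_comp _ _ _ (fun x : R => - (a * x ^+ 2)) expR).
  apply: cvgN; apply: cvgM; first exact: cvg_cst.
  exact: exprn_continuous.
exact: continuous_expR.
Qed.

Lemma measurable_gaussian a : measurable_fun [set: R] (gaussian a).
Proof. exact: continuous_measurable_fun (@continuous_gaussian a). Qed.

Lemma integral_gaussian_shift a m : 0 < a ->
  (\int[mu]_t (gaussian a (t - m))%:E)%E = (gaussian_mass a)%:E.
Proof.
move=> a0; under eq_integral do rewrite gaussian_normal_pdf// EFinM.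
rewrite integralZl//; last exact: integrable_normal_pdf.
by rewrite integral_normal_pdf mule1.
Qed.

Lemma integrable_gaussian a : 0 < a -> mu.-integrable setT (EFin \o gaussian a).
Proof.
move=> a0; rewrite (_ : EFin \o _ = (fun t => (gaussian_mass a)%:E *
    (normal_pdf 0 (Num.sqrt (2 * a))^-1 t)%:E)%E); last first.
  by apply/funext => t /=; rewrite -EFinM -gaussian_normal_pdf// subr0.
by apply: integrableZl => //; exact: integrable_normal_pdf.
Qed.

Lemma Rintegral_gaussian a : 0 < a ->
  \int[mu]_t gaussian a t = gaussian_mass a.
Proof.
move=> a0; rewrite /Rintegral (_ : (\int[mu]_t _)%E = (gaussian_mass a)%:E)//.
rewrite -(integral_gaussian_shift 0 a0).
by apply: eq_integral => t _; rewrite subr0.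
Qed.

Lemma integrable_gaussian_dominated a K (f : R -> R) : 0 < a ->
  continuous f -> (forall t, `|f t| <= K * gaussian a t) ->
  mu.-integrable setT (EFin \o f).
Proof.
move=> a0 cf fK.
apply: (@le_integrable _ _ _ mu _ _ _
  (fun t => K%:E * (gaussian a t)%:E)%E) => //.
- by apply/measurable_EFinP; exact: continuous_measurable_fun.
- move=> t _; rewrite -EFinM lee_fin (le_trans (fK t))//.
  exact: ler_norm.
- by apply: integrableZl => //; exact: integrable_gaussian.
Qed.

Lemma gaussian_half a t :
  gaussian a t = gaussian (a / 2) t * gaussian (a / 2) t.
Proof. by rewrite -expRD; congr expR; field. Qed.

(** Half of the Gaussian absorbs the polynomial factor; this dominates the
    derivative in the parameter of the Fourier integral of a Gaussian. *)
Lemma normM_gaussian_le a t : 0 < a ->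
  `|t| * gaussian a t <= (1 + 2 / a) * gaussian (a / 2) t.
Proof.
move=> a0; rewrite gaussian_half mulrA.
apply: ler_wpM2r; first exact/ltW/gaussian_gt0.
have a2 : 0 < a / 2 by lra.
have tE : `|t| <= 1 + t ^+ 2.
  by rewrite -(real_normK (num_real t)); nra.
have gE : (1 + a / 2 * t ^+ 2) * gaussian (a / 2) t <= 1.
  rewrite /gaussian expRN ler_pdivrMr ?expR_gt0// mul1r; exact: expR_ge1Dx.
have : `|t| <= (1 + 2 / a) * (1 + a / 2 * t ^+ 2).
  apply: (le_trans tE).
  have -> : (1 + 2 / a) * (1 + a / 2 * t ^+ 2) =
    1 + t ^+ 2 + (2 / a + a / 2 * t ^+ 2) by field; lra.
  by rewrite lerDl addr_ge0 ?(divr_ge0 _ (ltW a0))// mulr_ge0 ?sqr_ge0// ltW.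
move=> h; apply: (@le_trans _ _
  ((1 + 2 / a) * (1 + a / 2 * t ^+ 2) * gaussian (a / 2) t)).
  by rewrite ler_wpM2r// ltW// gaussian_gt0.
rewrite -mulrA -[leRHS]mulr1 ler_wpM2l//.
by rewrite addr_ge0// divr_ge0// ltW.
Qed.

Lemma is_derive_gaussian a t :
  is_derive t 1 (gaussian a) (- (2 * a * t) * gaussian a t).
Proof.
rewrite /gaussian.
apply: (@is_derive_eq _ _ _ (expR \o (fun t => - (a * t ^+ 2)))).
rewrite /= /GRing.scale/=; ring.
Qed.

Lemma is_derive_continuous (f F : R -> R) :
  (forall t, is_derive t 1 F (f t)) -> continuous F.
Proof.
by move=> dF t; apply/differentiable_continuous/derivable1_diffP.
Qed.

Lemma integral_segment_derive (f F : R -> R) x y : x < y ->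
  continuous f -> (forall t, is_derive t 1 F (f t)) ->
  (\int[mu]_(t in `[x, y]) (f t)%:E)%E = (F y - F x)%:E.
Proof.
move=> xy cf dF; have cF := is_derive_continuous dF.
rewrite (continuous_FTC2 (F := F))//.
- exact: continuous_subspaceT.
- split=> [t _| |].
  + by have [] := dF t.
  + exact/cvg_at_right_filter/cF.
  + exact/cvg_at_left_filter/cF.
- by move=> t _; rewrite derive1E; have [] := dF t.
Qed.

(** The fundamental theorem of calculus on the line: truncate to [-n, n] and
    use dominated convergence. *)
Lemma Rintegral_line_derive (f F : R -> R) (l : R) :
  continuous f -> (forall t, is_derive t 1 F (f t)) ->
  mu.-integrable setT (EFin \o f) ->
  F n%:R - F (- n%:R) @[n --> \oo] --> l ->
  \int[mu]_t f t = l.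
Proof.
move=> cf dF intf Fl.
pose I n : set R := `[- n%:R, n%:R]%classic.
pose f_ n t : \bar R := (f \_ (I n) t)%:E.
have mI n : measurable (I n) by exact: measurable_itv.
have mf : measurable_fun setT f by exact: continuous_measurable_fun.
have cvg_f : {ae mu, forall x, [set: R] x -> f_ ^~ x @ \oo --> (EFin \o f) x}.
  apply/aeW => t _; apply: cvg_near_cst; near=> n.
  rewrite /f_ /= patchE mem_set// /I/= in_itv/= -ler_norml.
  by near: n; apply: nbhs_infty_ger.
have mf_ n : measurable_fun setT (f_ n).
  apply/measurable_EFinP.
  by apply/(measurable_restrictT _ _).1 => //; exact: measurable_funTS.
have mfE : measurable_fun setT (EFin \o f) by exact/measurable_EFinP.
have dom_f : {ae mu, forall x n, [set: R] x ->
    (`|f_ n x| <= (abse \o (EFin \o f)) x)%E}.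
  apply/aeW => t n _; rewrite /f_ /= patchE lee_fin.
  by case: ifPn => // _; rewrite normr0.
have [_ _] := @dominated_convergence _ _ _ mu setT measurableT f_ (EFin \o f)
  (abse \o (EFin \o f)) mf_ mfE cvg_f (integrable_norm intf) dom_f.
have -> : [sequence (\int[mu]_x f_ n x)%E]_n =
    fun n : nat => (F n%:R - F (- n%:R))%:E.
  apply/funext => n /=.
  rewrite (_ : f_ n = (EFin \o f) \_ (I n)); last by rewrite restrict_EFin.
  rewrite -integral_mkcond.
  have [->|n0] := eqVneq n 0%N.
    by rewrite /I oppr0 set_itv1 integral_set1 subrr.
  by apply: integral_segment_derive => //; rewrite gtrN// ltr0n lt0n.
move=> /cvg_lim intE; rewrite /Rintegral -intE//.
have /cvg_lim -> // : (F n%:R - F (- n%:R))%:E @[n --> \oo] --> l%:E.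
by apply: cvg_EFin => //; exact: nearW.
Unshelve. all: by end_near. Qed.

End Gaussian.

(** * The Fourier transform of a Gaussian *)

Section TrigonometricGaussian.
Context {R : realType}.
Implicit Types (a c d e k t x y tau theta : R).
Local Notation mu := (@lebesgue_measure R).

(** The real part of (c + i d) e^{i theta}.  The imaginary part is
    [trig d (- c)], and the derivative in theta is [trig (- d) c]; working with
    this family avoids treating sines and cosines separately. *)
Definition trig c d theta : R := c * cos theta - d * sin theta.

Lemma is_derive_trig c d theta :
  is_derive theta 1 (trig c d) (trig (- d) c theta).
Proof.
rewrite /trig; apply: is_derive_eq.
rewrite /GRing.scale/=; ring.
Qed.

Lemma is_derive_trig_affine c d k e t :
  is_derive t 1 (fun t => trig c d (e + t * k)) (k * trig (- d) c (e + t * k)).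
Proof.
have h : is_derive t 1 (fun t : R => e + t * k) k.
  by apply: is_derive_eq; rewrite /GRing.scale/=; ring.
have := @is_derive1_comp _ (trig c d) (fun t : R => e + t * k) t _ _
  (is_derive_trig c d (e + t * k)) h.
by rewrite mulrC.
Qed.

Lemma continuous_trig_affine c d k e :
  continuous (fun t => trig c d (e + t * k)).
Proof. exact: is_derive_continuous (is_derive_trig_affine c d k e). Qed.

Lemma trigNN c d theta : trig (- c) (- d) theta = - trig c d theta.
Proof. by rewrite /trig; ring. Qed.

Lemma trigD c d x y : trig c d (x + y) = trig (trig c d x) (trig d (- c) x) y.
Proof. by rewrite /trig cosD sinD; ring. Qed.

Lemma norm_trig_le c d theta : `|trig c d theta| <= `|c| + `|d|.
Proof.
rewrite (le_trans (ler_normB _ _))// !normrM lerD// ler_piMr//.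
  by rewrite ler_norml cos_geN1 cos_le1.
by rewrite ler_norml sin_geN1 sin_le1.
Qed.

Lemma cvg_gaussian_nat a : 0 < a -> gaussian a n%:R @[n --> \oo] --> 0.
Proof.
move=> a0; have e1 : `|expR (- a)| < 1.
  by rewrite ger0_norm ?expR_ge0// expR_lt1 oppr_lt0.
apply: (@squeeze_cvgr _ _ _ _ (cst 0) (geometric 1 (expR (- a)))).
- apply: nearW => n /=; rewrite ltW ?gaussian_gt0//= mul1r -expRM_natl.
  rewrite ler_expR mulrN lerN2 mulrC ler_pM2l//.
  by rewrite -natrX ler_nat; case: n => // n; rewrite expnS leq_pmulr// expn1.
- exact: cvg_cst.
- exact: cvg_geometric.
Qed.

Lemma integrable_trig_gaussian a c d e k : 0 < a ->
  mu.-integrable setT (EFin \o (fun t => trig c d (e + t * k) * gaussian a t)).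
Proof.
move=> a0; apply: (@integrable_gaussian_dominated _ a (`|c| + `|d|)) => //.
  move=> t; apply: cvgM; first exact: continuous_trig_affine.
  exact: continuous_gaussian.
move=> t; rewrite normrM (ger0_norm (ltW (gaussian_gt0 a t))).
by apply: ler_wpM2r (norm_trig_le _ _ _); exact/ltW/gaussian_gt0.
Qed.

Lemma norm_id_trig_gaussian_le a c d e k t : 0 < a ->
  `|t * trig c d (e + t * k) * gaussian a t| <=
    (`|c| + `|d|) * (1 + 2 / a) * gaussian (a / 2) t.
Proof.
move=> a0; rewrite !normrM (ger0_norm (ltW (gaussian_gt0 a t))).
rewrite (mulrC `|t|) -!mulrA; apply: ler_pM => //.
- by rewrite mulr_ge0// ltW// gaussian_gt0.
- exact: norm_trig_le.
- exact: normM_gaussian_le.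
Qed.

Lemma integrable_id_trig_gaussian a c d e k : 0 < a ->
  mu.-integrable setT
    (EFin \o (fun t => t * trig c d (e + t * k) * gaussian a t)).
Proof.
move=> a0; apply: (@integrable_gaussian_dominated _ (a / 2)
    ((`|c| + `|d|) * (1 + 2 / a))).
- by rewrite divr_gt0.
- move=> t; apply: cvgM; last exact: continuous_gaussian.
  by apply: cvgM; [exact: cvg_id|exact: continuous_trig_affine].
- by move=> t; exact: norm_id_trig_gaussian_le.
Qed.

(** Integration by parts against the derivative - 2 a t of the Gaussian; it
    turns the differentiated Fourier integral back into the integral itself. *)
Lemma Rintegral_id_trig_gaussian a c d k : 0 < a ->
  2 * a * \int[mu]_t (t * trig (- d) c (0 + t * k) * gaussian a t) =
  - (k * \int[mu]_t (trig c d (0 + t * k) * gaussian a t)).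
Proof.
move=> a0.
rewrite -RintegralZl//; last exact: integrable_id_trig_gaussian.
rewrite -RintegralZl//; last exact: integrable_trig_gaussian.
apply/eqP; rewrite -addr_eq0; apply/eqP.
have i1 := integrable_id_trig_gaussian (- d) c 0 k a0.
have i2 := integrable_trig_gaussian c d 0 k a0.
have i1' : mu.-integrable setT (EFin \o
    (fun t => 2 * a * (t * trig (- d) c (0 + t * k) * gaussian a t))).
  exact: integrableZl measurableT (2 * a) _ i1.
have i2' : mu.-integrable setT (EFin \o
    (fun t => k * (trig c d (0 + t * k) * gaussian a t))).
  exact: integrableZl measurableT k _ i2.
rewrite -RintegralD//.
(* F is a primitive of the sum of the two integrands. *)
pose F := - ((fun t => trig (- d) c (0 + t * k)) * gaussian a).
apply: (@Rintegral_line_derive _ _ F).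
- move=> t; apply: cvgD; apply: cvgM; try exact: cvg_cst.
  + apply: cvgM; last exact: continuous_gaussian.
    by apply: cvgM; [exact: cvg_id|exact: continuous_trig_affine].
  + by apply: cvgM; [exact: continuous_trig_affine|exact: continuous_gaussian].
- move=> t; have h1 := is_derive_trig_affine (- d) c k 0 t.
  have h2 := is_derive_gaussian a t.
  apply: (is_derive_eq (is_deriveN (is_deriveM h1 h2))).
  by rewrite /GRing.scale/= trigNN; ring.
- by have := integrableD measurableT i1' i2'; apply: eq_integrable.
- pose K := `|- d| + `|c|.
  have FK t : `|F t| <= K * gaussian a t.
    rewrite normrN normrM (ger0_norm (ltW (gaussian_gt0 a t))).
    by apply: ler_wpM2r (norm_trig_le _ _ _); exact/ltW/gaussian_gt0.
  apply: norm_cvg0.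
  apply: (@squeeze_cvgr _ _ _ _ (cst 0) (fun n => (K + K) * gaussian a n%:R)).
  + apply: nearW => n; rewrite normr_ge0/= (le_trans (ler_normB _ _))// mulrDl.
    by rewrite lerD// (le_trans (FK _))// /gaussian sqrrN.
  + exact: cvg_cst.
  + rewrite -(mulr0 (K + K)); apply: cvgM; first exact: cvg_cst.
    exact: cvg_gaussian_nat.
Qed.

(** The Fourier transform of the Gaussian.  By [Rintegral_id_trig_gaussian],
    the integral F solves F' = - tau / (2 a) F, so F e^{tau^2 / (4 a)} is
    constant. *)
Lemma Rintegral_trig_gaussian a c d tau : 0 < a ->
  \int[mu]_t (trig c d (t * tau) * gaussian a t) =
  c * gaussian_mass a * gaussian (4 * a)^-1 tau.
Proof.
move=> a0; pose f k t := trig c d (0 + t * k) * gaussian a t.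
pose F k := \int[mu]_t f k t.
have -> : \int[mu]_t (trig c d (t * tau) * gaussian a t) = F tau.
  by apply: eq_Rintegral => t _; rewrite /f add0r.
have df k t : is_derive k 1 (f ^~ t)
    (t * trig (- d) c (0 + t * k) * gaussian a t).
  rewrite /f; under eq_fun do rewrite mulrC (mulrC t).
  apply: is_derive_eq
    (is_deriveZ (gaussian a t) (is_derive_trig_affine c d t 0 k)) _.
  by rewrite /GRing.scale/= (mulrC k); ring.
have d1f k t : partial1of2 f k t = t * trig (- d) c (0 + t * k) * gaussian a t.
  by rewrite partial1of2E; have [_ ->] := df k t.
have dF k : is_derive k 1 F (- (k / (2 * a)) * F k).
  have Ik : `]k - 1, k + 1[%classic k by rewrite /= in_itv/=; lra.
  pose G t := (`|- d| + `|c|) * (1 + 2 / a) * gaussian (a / 2) t.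
  have fi x : `]k - 1, k + 1[%classic x -> mu.-integrable setT (EFin \o f x).
    by move=> _; exact: integrable_trig_gaussian.
  have fd x t : `]k - 1, k + 1[%classic x -> [set: R] t ->
      derivable (f ^~ t) x 1.
    by move=> _ _; have [] := df x t.
  have G0 t : 0 <= G t.
    rewrite mulr_ge0 ?(ltW (gaussian_gt0 _ _))// mulr_ge0//.
    by rewrite addr_ge0// divr_ge0// ltW.
  have Gi : mu.-integrable setT (EFin \o G).
    have i := @integrable_gaussian R (a / 2) (divr_gt0 a0 (ltr0n _ 2)).
    have := integrableZl measurableT ((`|- d| + `|c|) * (1 + 2 / a)) i.
    exact: eq_integrable.
  have Gf x t : `]k - 1, k + 1[%classic x -> [set: R] t ->
      `|partial1of2 f x t| <= G t.
    by move=> _ _; rewrite d1f; exact: norm_id_trig_gaussian_le.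
  have dFk := derivable_under_integral measurableT Ik fi fd G0 Gi Gf.
  apply: DeriveDef; first exact: dFk.
  have := differentiation_under_integral measurableT Ik fi fd G0 Gi Gf.
  rewrite derive1E => ->.
  under eq_Rintegral do rewrite d1f.
  apply: (@mulfI _ (2 * a)); first by rewrite gt_eqF// mulr_gt0.
  rewrite Rintegral_id_trig_gaussian// -/(F k).
  by field; rewrite gt_eqF.
have dE k : is_derive k 1 (fun k => expR ((4 * a)^-1 * k ^+ 2))
   (k / (2 * a) * expR ((4 * a)^-1 * k ^+ 2)).
  apply: (@is_derive_eq _ _ _ (expR \o (fun k => (4 * a)^-1 * k ^+ 2))).
  by rewrite /GRing.scale/=; field; rewrite gt_eqF.
have dP k : is_derive k 1 (F * (fun k => expR ((4 * a)^-1 * k ^+ 2))) 0.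
  apply: is_derive_eq (is_deriveM (dF k) (dE k)) _.
  by rewrite /GRing.scale/=; ring.
have := is_derive_0_is_cst tau 0 dP; rewrite !fctE expr0n/= mulr0 expR0 mulr1.
have -> : F 0 = c * gaussian_mass a.
  rewrite -Rintegral_gaussian// -RintegralZl//; last exact: integrable_gaussian.
  by apply: eq_Rintegral => t _; rewrite /f mulr0 addr0 /trig cos0 sin0; ring.
by move=> <-; rewrite -mulrA -expRD subrr expR0 mulr1.
Qed.

End TrigonometricGaussian.

(** * Gaussian wave packets are Schwartz functions *)

Section Waves.
Context {R : realType}.
Implicit Types (a c d t x xi sigma lambda : R) (p q : {poly R}) (k : int).
Local Notation mu := (@lebesgue_measure R).
Local Open Scope complex_scope.

(** The real part of (p(t) + i q(t)) e^{i (x xi + t sigma)} e^{- a t^2}.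
    Polynomial amplitudes are there to make the family stable under
    derivation in t. *)
Definition rewave xi sigma a p q x t : R :=
  trig p.[t] q.[t] (x * xi + t * sigma) * gaussian a t.

Definition wave xi sigma a p q x t : R[i] :=
  rewave xi sigma a p q x t +i* rewave xi sigma a q (- p) x t.

Lemma is_derive_rewave_x xi sigma a p q x t :
  is_derive x 1 (rewave xi sigma a p q ^~ t)
    (rewave xi sigma a (- (xi *: q)) (xi *: p) x t).
Proof.
have h := is_derive_trig_affine p.[t] q.[t] xi (t * sigma) x.
rewrite /rewave; under eq_fun do rewrite (addrC (_ * xi)) mulrC.
apply: is_derive_eq (is_deriveZ (gaussian a t) h) _.
rewrite (addrC (t * sigma)) /trig !hornerE /GRing.scale/=; ring.
Qed.

Lemma is_derive_rewave_t xi sigma a p q x t :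
  is_derive t 1 (rewave xi sigma a p q x)
    (rewave xi sigma a (p^`() - (2 * a) *: ('X * p) - sigma *: q)
       (q^`() - (2 * a) *: ('X * q) + sigma *: p) x t).
Proof.
have hc := is_derive_trig_affine 1 0 sigma (x * xi) t.
have hs := is_derive_trig_affine 0 (- 1) sigma (x * xi) t.
have hg := is_derive_gaussian a t.
have -> : rewave xi sigma a p q x =
  (horner p * (fun t => trig 1 0 (x * xi + t * sigma)) -
   horner q * (fun t => trig 0 (- 1) (x * xi + t * sigma))) * gaussian a.
  apply/funext => y; rewrite /rewave !fctE /trig; ring.
apply: is_derive_eq (is_deriveM (is_deriveB (is_deriveM (is_derive_poly p t) hc)
  (is_deriveM (is_derive_poly q t) hs)) hg) _.
by rewrite !fctE /rewave /trig !hornerE /GRing.scale/=; ring.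
Qed.

Lemma partial_x_wave xi sigma a p q :
  partial_x (wave xi sigma a p q) = wave xi sigma a (- (xi *: q)) (xi *: p).
Proof.
apply/funext => x; apply/funext => t; rewrite /partial_x /wave/=.
have [_ h1] := is_derive_rewave_x xi sigma a p q x t.
have [_ h2] := is_derive_rewave_x xi sigma a q (- p) x t.
by rewrite !derive1E h1 h2 scalerN !opprK.
Qed.

Lemma partial_t_wave xi sigma a p q : partial_t (wave xi sigma a p q) =
  wave xi sigma a (p^`() - (2 * a) *: ('X * p) - sigma *: q)
    (q^`() - (2 * a) *: ('X * q) + sigma *: p).
Proof.
apply/funext => x; apply/funext => t; rewrite /partial_t /wave/=.
have [_ h1] := is_derive_rewave_t xi sigma a p q x t.
have [_ h2] := is_derive_rewave_t xi sigma a q (- p) x t.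
rewrite !derive1E h1 h2; congr (_ +i* rewave _ _ _ _ _ _ _).
  by rewrite scalerN opprK.
by rewrite derivN mulrN scalerN !opprD !opprK.
Qed.

Lemma has_partials_wave xi sigma a p q : has_partials (wave xi sigma a p q).
Proof.
move=> x t; split.
- by have [] := is_derive_rewave_x xi sigma a p q x t.
- by have [] := is_derive_rewave_x xi sigma a q (- p) x t.
- by have [] := is_derive_rewave_t xi sigma a p q x t.
- by have [] := is_derive_rewave_t xi sigma a q (- p) x t.
Qed.

Lemma continuous_rewave xi sigma a p q :
  continuous (fun z : R * R => rewave xi sigma a p q z.1 z.2).
Proof.
move=> z.
have c2 (f : R -> R) : continuous f ->
    {for z, continuous (fun z : R * R => f z.2)}.
  move=> cf; apply: (@continuous_comp _ _ _ snd f); last exact: cf.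
  exact: cvg_snd.
have cphi : {for z, continuous (fun z : R * R => z.1 * xi + z.2 * sigma)}.
  apply: cvgD; apply: cvgM; try exact: cvg_cst; [exact: cvg_fst|exact: cvg_snd].
apply: cvgM; last exact: c2 (@continuous_gaussian _ a).
apply: cvgB; apply: cvgM; try exact: c2 (@continuous_horner _ _).
- exact: (@continuous_comp _ _ _ _ cos _ cphi (@continuous_cos _ _)).
- exact: (@continuous_comp _ _ _ _ sin _ cphi (@continuous_sin _ _)).
Qed.

(** |t|^n is at most 1 + (t^2)^(n+1), and (a t^2)^(n+1) / (n+1)! is a term of
    the exponential series of a t^2. *)
Lemma bounded_expn_gaussian a n : 0 < a ->
  exists M, forall t, `|t| ^+ n * gaussian a t <= M.
Proof.
move=> a0; exists (1 + n.+1`!%:R / a ^+ n.+1) => t.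
have tn : `|t| ^+ n <= 1 + (t ^+ 2) ^+ n.+1.
  rewrite -(real_normK (num_real t)) -exprM.
  have [t1|/ltW t1] := leP `|t| 1.
    by rewrite (le_trans (exprn_ile1 n (normr_ge0 t) t1))// lerDl exprn_ge0.
  by rewrite -[leLHS]add0r lerD// ler_weXn2l//; lia.
apply: (le_trans (ler_wpM2r (ltW (gaussian_gt0 a t)) tn)).
rewrite mulrDl mul1r lerD//.
  by rewrite /gaussian -[leRHS]expR0 ler_expR oppr_le0 mulr_ge0 ?sqr_ge0// ltW.
have h : (a * t ^+ 2) ^+ n.+1 / n.+1`!%:R <= expR (a * t ^+ 2).
  have at0 : 0 <= a * t ^+ 2 by rewrite mulr_ge0 ?sqr_ge0// ltW.
  by apply: le_trans (expR_ge1Dxn n at0); rewrite lerDr.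
rewrite /gaussian expRN ler_pdivrMr ?expR_gt0//.
rewrite mulrAC ler_pdivlMr ?exprn_gt0// mulrC -exprMn [leRHS]mulrC.
by rewrite -ler_pdivrMr// ltr0n fact_gt0.
Qed.

Lemma bounded_expn_poly_gaussian a n p : 0 < a ->
  exists M, forall t, `|t| ^+ n * (`|p.[t]| * gaussian a t) <= M.
Proof.
move=> a0; elim/poly_ind: p n => [|p c IH] n.
  by exists 0 => t; rewrite horner0 normr0 mul0r mulr0.
have [M1 H1] := IH n.+1; have [M2 H2] := bounded_expn_gaussian n a0.
exists (M1 + `|c| * M2) => t.
apply: le_trans (lerD (H1 t) (ler_wpM2l (normr_ge0 c) (H2 t))).
rewrite hornerMXaddC.
apply: (@le_trans _ _ (`|t| ^+ n * ((`|p.[t]| * `|t| + `|c|) * gaussian a t))).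
  rewrite ler_wpM2l ?exprn_ge0// ler_wpM2r ?(ltW (gaussian_gt0 _ _))//.
  by rewrite -normrM ler_normD.
by rewrite exprSr; apply: eq_ler; ring.
Qed.

Lemma normc_le (y z : R) : ComplexField.Normc.normc (y +i* z) <= `|y| + `|z|.
Proof.
rewrite /= -[leRHS]ger0_norm ?addr_ge0// -sqrtr_sqr ler_sqrt ?sqr_ge0//.
rewrite sqrrD !real_normK ?num_real// lerD2r lerDl.
by rewrite mulrn_wge0// mulr_ge0.
Qed.

Lemma rapidly_decreasing_wave xi sigma a p q : 0 < a ->
  rapidly_decreasing_in_t (wave xi sigma a p q).
Proof.
move=> a0 m; have [M1 H1] := bounded_expn_poly_gaussian m p a0.
have [M2 H2] := bounded_expn_poly_gaussian m q a0.
have le p1 q1 x t : `|rewave xi sigma a p1 q1 x t| <=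
    `|p1.[t]| * gaussian a t + `|q1.[t]| * gaussian a t.
  rewrite normrM (ger0_norm (ltW (gaussian_gt0 a t))) -mulrDl.
  by apply: ler_wpM2r (norm_trig_le _ _ _); exact/ltW/gaussian_gt0.
exists (M1 + M2 + (M2 + M1)) => x t.
apply: le_trans (lerD (lerD (H1 t) (H2 t)) (lerD (H2 t) (H1 t))).
rewrite -!mulrDr ler_wpM2l ?exprn_ge0//.
apply: (le_trans (normc_le _ _)); rewrite lerD//.
by apply: le_trans (le _ _ _ _) _; rewrite hornerN normrN.
Qed.

Lemma iter_partial_wave xi sigma a (j i : nat) p q : exists p' q',
  iter j (@partial_x R) (iter i (@partial_t R) (wave xi sigma a p q)) =
  wave xi sigma a p' q'.
Proof.
elim: j => [|j [p' [q' IH]]] /=.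
  elim: i => [|i [p' [q' IH]]] /=; first by exists p, q.
  by rewrite IH partial_t_wave; eexists; eexists.
by rewrite IH partial_x_wave; eexists; eexists.
Qed.

Lemma trig_periodic_int c d theta k :
  trig c d (theta + 2 * pi * k%:~R) = trig c d theta.
Proof.
have n2pi (n : nat) y : trig c d (y + 2 * pi * n%:R) = trig c d y.
  rewrite mulr_natr mulr_natl /trig.
  by rewrite (periodicn (@cosD2pi R)) (periodicn (@sinD2pi R)).
case: k => n; first exact: n2pi.
by rewrite -[LHS](n2pi n.+1) NegzE mulrNz mulrN -pmulrn subrK.
Qed.

Lemma schwartz_wave lambda k sigma a p q : 0 < lambda -> 0 < a ->
  schwartz lambda (wave (freq lambda k) sigma a p q).
Proof.
move=> l0 a0; split=> [x t|j i].
  have per p1 q1 :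
      rewave (freq lambda k) sigma a p1 q1 (x + 2 * pi * lambda) t =
      rewave (freq lambda k) sigma a p1 q1 x t.
    rewrite /rewave -[in RHS](trig_periodic_int _ _ _ k) /freq.
    by congr (trig _ _ _ * _); field; rewrite gt_eqF.
  by rewrite /wave !per.
have [p' [q' ->]] := iter_partial_wave (freq lambda k) sigma a j i p q.
split; last exact: rapidly_decreasing_wave.
  by split; exact: continuous_rewave.
exact: has_partials_wave.
Qed.

(** The time profiles multiply to a Gaussian with parameter 2 a. *)
Lemma wave_mul xi1 sigma1 xi2 sigma2 a x t :
  wave xi1 sigma1 a 1 0 x t * wave xi2 sigma2 a 1 0 x t =
  wave (xi1 + xi2) (sigma1 + sigma2) (2 * a) 1 0 x t.
Proof.
have gE : gaussian (2 * a) t = gaussian a t * gaussian a t.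
  by rewrite /gaussian -expRD; congr expR; ring.
have phE : x * (xi1 + xi2) + t * (sigma1 + sigma2) =
  (x * xi1 + t * sigma1) + (x * xi2 + t * sigma2) by ring.
apply/eqP; rewrite eq_complex /= /rewave hornerN horner0 hornerC gE phE.
move: (x * xi1 + t * sigma1) (x * xi2 + t * sigma2) => y z.
by rewrite /trig cosD sinD; apply/andP; split; apply/eqP; ring.
Qed.

End Waves.

(** * The space-time Fourier transform of a wave packet *)

Section FourierWave.
Context {R : realType}.
Implicit Types (a c d t x y xi sigma tau lambda : R) (k : int).
Local Notation mu := (@lebesgue_measure R).
Local Open Scope complex_scope.

(** Orthogonality of the characters of the torus. *)
Lemma Rintegral_period_trig lambda c d k K : 0 < lambda ->
  \int[mu]_(x in `[0, 2 * pi * lambda[) (trig c d (x * freq lambda k) * K) =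
  if k == 0 then 2 * pi * lambda * (c * K) else 0.
Proof.
move=> l0; have L0 : 0 < 2 * pi * lambda by rewrite !mulr_gt0// pi_gt0.
have cf : continuous (fun x => trig c d (0 + x * freq lambda k) * K).
  by move=> x; apply: cvgM; [exact: continuous_trig_affine|exact: cvg_cst].
transitivity (\int[mu]_(x in `[0, 2 * pi * lambda])
    (trig c d (0 + x * freq lambda k) * K)).
  rewrite -Rintegral_itv_bndo_bndc.
    by apply: eq_Rintegral => x _; rewrite add0r.
  apply: (@integrableS _ _ _ mu `[0, 2 * pi * lambda]%classic) => //.
    exact: subset_itv_co_cc.
  apply: continuous_compact_integrable; first exact: segment_compact.
  exact: continuous_subspaceT.
have [->|k0] := eqVneq k 0.
  under eq_Rintegral do
    rewrite /freq mul0r mulr0 addr0 /trig cos0 sin0 mulr1 mulr0 subr0.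
  rewrite Rintegral_cst//= lebesgue_measure_itv/= lte_fin L0 oppr0 adde0/=.
  by rewrite mulrC.
have f0 : freq lambda k != 0.
  by rewrite mulf_neq0 ?intr_eq0// invr_neq0// gt_eqF.
pose F x := (K / freq lambda k) * trig d (- c) (0 + x * freq lambda k).
have dF x : is_derive x 1 F (trig c d (0 + x * freq lambda k) * K).
  apply: is_derive_eq (is_deriveZ _ (is_derive_trig_affine d (- c) _ 0 x)) _.
  by rewrite opprK /GRing.scale/=; field.
rewrite /Rintegral (integral_segment_derive L0 cf dF)/= /F mul0r.
have -> : 0 + 2 * pi * lambda * freq lambda k = 0 + 0 + 2 * pi * k%:~R.
  by rewrite /freq; field; rewrite gt_eqF.
by rewrite trig_periodic_int !addr0 subrr.
Qed.

Lemma wave_polyC xi sigma a c d x t : wave xi sigma a c%:P d%:P x t =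
  (trig c d (x * xi + t * sigma) * gaussian a t) +i*
  (trig d (- c) (x * xi + t * sigma) * gaussian a t).
Proof. by rewrite /wave /rewave hornerN !hornerC. Qed.

(** The phases of the wave and of the character combine into the single phase
    x (xi - eta) + t (sigma - tau), which reduces the t-integral to
    [Rintegral_trig_gaussian]. *)
Lemma Cintegral_line_wave xi sigma a c d eta tau x : 0 < a ->
  Cintegral setT (fun t =>
    expi (- (x * eta + t * tau)) * wave xi sigma a c%:P d%:P x t) =
  (trig c d (x * (xi - eta)) *
    (gaussian_mass a * gaussian (4 * a)^-1 (sigma - tau))) +i*
  (trig d (- c) (x * (xi - eta)) *
    (gaussian_mass a * gaussian (4 * a)^-1 (sigma - tau))).
Proof.
move=> a0.
have E t : expi (- (x * eta + t * tau)) * wave xi sigma a c%:P d%:P x t =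
  (trig (trig c d (x * (xi - eta))) (trig d (- c) (x * (xi - eta)))
    (t * (sigma - tau)) * gaussian a t) +i*
  (trig (trig d (- c) (x * (xi - eta))) (trig (- c) (- d) (x * (xi - eta)))
    (t * (sigma - tau)) * gaussian a t).
  rewrite wave_polyC -!trigD.
  have -> : x * (xi - eta) + t * (sigma - tau) =
    x * xi + t * sigma + - (x * eta + t * tau) by ring.
  move: (x * xi + t * sigma) (- (x * eta + t * tau)) => y z.
  apply/eqP; rewrite eq_complex /= /trig cosD sinD.
  by apply/andP; split; apply/eqP; ring.
rewrite /Cintegral; congr (_ +i* _).
- under eq_Rintegral do rewrite E/=.
  by rewrite Rintegral_trig_gaussian// mulrA.
- under eq_Rintegral do rewrite E/=.
  by rewrite Rintegral_trig_gaussian// mulrA.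
Qed.

Lemma fourier_wave lambda k1 sigma a c d k tau : 0 < lambda -> 0 < a ->
  fourier lambda (wave (freq lambda k1) sigma a c%:P d%:P) k tau =
  if k == k1 then
    (2 * pi * lambda * gaussian_mass a * gaussian (4 * a)^-1 (sigma - tau))%:C *
      (c +i* d)
  else 0.
Proof.
move=> l0 a0; rewrite /fourier.
rewrite (funext (fun x => Cintegral_line_wave _ _ _ _ _ _ x a0)).
have -> : freq lambda k1 - freq lambda k = freq lambda (k1 - k).
  by rewrite /freq -mulrBl intrB.
rewrite /Cintegral/= !Rintegral_period_trig// subr_eq0 eq_sym.
case: ifP => // _; apply/eqP; rewrite eq_complex /=.
by apply/andP; split; apply/eqP; ring.
Qed.

End FourierWave.

(** * The Japanese bracket *)

Section Bracket.
Context {R : realType}.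
Implicit Types (x y b e : R).

Lemma bracket_ge1 y : 1 <= bracket y.
Proof. by rewrite lerDl. Qed.

Lemma bracket_gt0 y : 0 < bracket y.
Proof. exact: lt_le_trans ltr01 (bracket_ge1 y). Qed.

Lemma bracket_ge0 y : 0 <= bracket y.
Proof. exact/ltW/bracket_gt0. Qed.

Lemma bracketN y : bracket (- y) = bracket y.
Proof. by rewrite /bracket normrN. Qed.

Lemma bracketD_le x y : bracket (x + y) <= bracket x * bracket y.
Proof.
rewrite /bracket; apply: (@le_trans _ _ (1 + (`|x| + `|y|))).
  by rewrite lerD2l ler_normD.
have := mulr_ge0 (normr_ge0 x) (normr_ge0 y); lra.
Qed.

Lemma bracket_powR_gt0 y b : 0 < bracket y `^ b.
Proof. exact/powR_gt0/bracket_gt0. Qed.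

(** Peetre's inequality.  For b < 0 it is the case of exponent - b for
    the pair x + y, - y. *)
Lemma peetre x y b :
  bracket (x + y) `^ b <= bracket x `^ b * bracket y `^ `|b|.
Proof.
have [b0|b0] := leP 0 b.
  rewrite (ger0_norm b0) -powRM ?bracket_ge0//.
  apply: ge0_ler_powR => //; rewrite ?nnegrE ?mulr_ge0 ?bracket_ge0//.
  exact: bracketD_le.
rewrite (ltr0_norm b0) -{1 2}(opprK b) !(powRN _ (- b)).
rewrite -ler_pdivrMr ?bracket_powR_gt0// -invfM lef_pV2 ?posrE; last 2 first.
- by rewrite mulr_gt0// bracket_powR_gt0.
- exact: bracket_powR_gt0.
rewrite -powRM ?bracket_ge0//.
apply: ge0_ler_powR.
- by rewrite oppr_ge0 ltW.
- by rewrite nnegrE bracket_ge0.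
- by rewrite nnegrE mulr_ge0 ?bracket_ge0.
have := bracketD_le (x + y) (- y).
by rewrite addrK bracketN.
Qed.

Lemma peetre_lower x y b :
  bracket x `^ b * bracket y `^ (- `|b|) <= bracket (x + y) `^ b.
Proof.
rewrite powRN ler_pdivrMr ?bracket_powR_gt0//.
by have := peetre (x + y) (- y) b; rewrite addrK bracketN.
Qed.

(** From 1 + |y| <= e^{|y|} the left-hand side is at most
    e^{b |y| - 2 e y^2}, and b |y| <= e y^2 + b^2 / (4 e) by completing the
    square. *)
Lemma bracket_powR_gaussian_le e b y : 0 < e -> 0 <= b ->
  bracket y `^ b * gaussian (2 * e) y <= expR (b ^+ 2 / (4 * e)) * gaussian e y.
Proof.
move=> e0 b0.
have h : bracket y `^ b <= expR (b * `|y|).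
  rewrite mulrC expRM; apply: ge0_ler_powR => //.
  - by rewrite nnegrE bracket_ge0.
  - by rewrite nnegrE expR_ge0.
  - exact: expR_ge1Dx.
apply: (le_trans (ler_wpM2r (ltW (gaussian_gt0 _ _)) h)).
rewrite -!expRD ler_expR -(real_normK (num_real y)).
have -> : b ^+ 2 / (4 * e) - e * `|y| ^+ 2 =
    b * `|y| - 2 * e * `|y| ^+ 2 + e * (`|y| - b / (2 * e)) ^+ 2.
  by field; rewrite gt_eqF.
by rewrite lerDl mulr_ge0 ?sqr_ge0// ltW.
Qed.

Lemma measurable_bracket_powR x b :
  measurable_fun [set: R] (fun y => bracket (y - x) `^ b).
Proof.
apply: (measurableT_comp (measurable_powR b)).
apply: continuous_measurable_fun => y; apply: cvgD; first exact: cvg_cst.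
by apply: cvg_norm; apply: cvgB; [exact: cvg_id|exact: cvg_cst].
Qed.

End Bracket.

(** * Mixed norms of functions carried by one frequency *)

Section SpaceTimeNorms.
Context {R : realType}.
Implicit Types (a b c d s sigma tau alpha lambda K : R) (k : int) (z : R[i]).
Local Notation mu := (@lebesgue_measure R).
Local Notation normc := ComplexField.Normc.normc.
Local Open Scope complex_scope.

Lemma normc_real (x : R) : normc x%:C = `|x|.
Proof. by rewrite /= expr0n addr0 sqrtr_sqr. Qed.

Lemma normc_ge0 z : 0 <= normc z.
Proof. by case: z => x y; exact: sqrtr_ge0. Qed.

(** At a single frequency the norm is the value there, up to the square root of
    the mass of a point. *)
Lemma L2xi_supp1 lambda k1 (F : int -> \bar R) : 0 < lambda ->
  (forall k, k != k1 -> F k = 0%E) -> (0 <= F k1)%E ->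
  L2xi lambda F = (((2 * pi * lambda)^-1 `^ 2^-1)%:E * F k1)%E.
Proof.
move=> l0 F0 Fk; rewrite /L2xi.
have -> : (\esum_(k in [set: int]) F k `^ 2 = F k1 `^ 2)%E.
  rewrite -[RHS](esum_set1 (t := k1) (a := fun k => F k `^ 2)%E) ?poweR_ge0//.
  rewrite [RHS]esum_mkcond; apply: eq_esum => k _.
  case: ifPn => // /negP kk1; rewrite F0 ?poweR0r//.
  by apply/eqP => kE; apply: kk1; rewrite kE inE.
have c0 : 0 <= (2 * pi * lambda)^-1 by rewrite invr_ge0 !mulr_ge0 ?pi_ge0// ltW.
rewrite poweRM ?lee_fin ?poweR_ge0// poweR_EFin; congr (_ * _)%E.
by rewrite -poweRrM divff// poweRe1.
Qed.

Lemma L2tau0 : L2tau (fun _ : R => 0 : R[i]) = 0%E.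
Proof.
rewrite /L2tau integral0_eq ?poweR0r// => t _.
by rewrite ComplexField.Normc.normc0 expr0n.
Qed.

Lemma L1tau0 : L1tau (fun _ : R => 0 : R[i]) = 0%E.
Proof.
by rewrite /L1tau integral0_eq// => t _; rewrite ComplexField.Normc.normc0.
Qed.

Lemma L2tau_ge0 (f : R -> R[i]) : (0 <= L2tau f)%E.
Proof. exact: poweR_ge0. Qed.

Lemma L1tau_ge0 (f : R -> R[i]) : (0 <= L1tau f)%E.
Proof. by apply: integral_ge0 => t _; rewrite lee_fin normc_ge0. Qed.

Lemma L2tau_le (r : R -> R) z a sigma K : 0 < a -> 0 <= K ->
  measurable_fun setT r ->
  (forall tau, `|r tau| <= K * gaussian a (tau - sigma)) ->
  (L2tau (fun tau => (r tau)%:C * z)%R <=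
    (K * normc z * Num.sqrt (gaussian_mass (2 * a)))%:E)%E.
Proof.
move=> a0 K0 mr rK; have a20 : 0 < 2 * a by rewrite mulr_gt0.
have -> : (K * normc z * Num.sqrt (gaussian_mass (2 * a)))%:E =
    (((K * normc z) ^+ 2 * gaussian_mass (2 * a))%:E `^ 2^-1)%E.
  rewrite poweR_EFin powR12_sqrt.
    by rewrite sqrtrM ?sqr_ge0// sqrtr_sqr ger0_norm// mulr_ge0// normc_ge0.
  by rewrite mulr_ge0 ?sqr_ge0// ltW// gaussian_mass_gt0.
have rE tau : normc ((r tau)%:C * z) ^+ 2 = (r tau) ^+ 2 * normc z ^+ 2.
  by rewrite ComplexField.Normc.normcM normc_real exprMn real_normK// num_real.
have mz : measurable_fun setT (fun tau => (r tau ^+ 2 * normc z ^+ 2)%:E).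
  by apply/measurable_EFinP/measurable_funM => //; exact: measurable_funX.
have mg : measurable_fun setT (fun tau => (gaussian (2 * a) (tau - sigma))%:E).
  apply/measurable_EFinP; apply: (measurableT_comp (measurable_gaussian _)).
  exact: measurable_funB.
rewrite /L2tau; under eq_integral do rewrite rE.
apply: gt0_ler_poweR; rewrite ?invr_ge0//.
- rewrite in_itv/= leey andbT; apply: integral_ge0 => tau _.
  by rewrite lee_fin mulr_ge0// sqr_ge0.
- rewrite in_itv/= leey andbT lee_fin mulr_ge0 ?sqr_ge0//.
  exact/ltW/gaussian_mass_gt0.
rewrite EFinM -(integral_gaussian_shift sigma a20).
rewrite -ge0_integralZl//; last 2 first.
- by move=> tau _; rewrite lee_fin ltW// gaussian_gt0.
- by rewrite lee_fin sqr_ge0.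
apply: ge0_le_integral => //.
- by move=> tau _; rewrite lee_fin mulr_ge0// sqr_ge0.
- exact: measurable_funeM.
move=> tau _; rewrite -EFinM lee_fin exprMn [leRHS]mulrAC.
apply: ler_wpM2r; first exact: sqr_ge0.
rewrite -(real_normK (num_real (r tau))).
have -> : gaussian (2 * a) (tau - sigma) = gaussian a (tau - sigma) ^+ 2.
  by rewrite expr2 -expRD; congr expR; ring.
by rewrite -exprMn lerXn2r ?nnegrE// mulr_ge0// ltW// gaussian_gt0.
Qed.

Lemma L1tau_le (r : R -> R) z a sigma K : 0 < a -> 0 <= K ->
  measurable_fun setT r ->
  (forall tau, `|r tau| <= K * gaussian a (tau - sigma)) ->
  (L1tau (fun tau => (r tau)%:C * z)%R <=
    (K * normc z * gaussian_mass a)%:E)%E.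
Proof.
move=> a0 K0 mr rK.
have rE tau : normc ((r tau)%:C * z) = `|r tau| * normc z.
  by rewrite ComplexField.Normc.normcM normc_real.
have mz : measurable_fun setT (fun tau => (`|r tau| * normc z)%:E).
  by apply/measurable_EFinP/measurable_funM => //; exact: measurableT_comp.
have mg : measurable_fun setT (fun tau => (gaussian a (tau - sigma))%:E).
  apply/measurable_EFinP; apply: (measurableT_comp (measurable_gaussian _)).
  exact: measurable_funB.
rewrite /L1tau; under eq_integral do rewrite rE.
rewrite EFinM -(integral_gaussian_shift sigma a0).
rewrite -ge0_integralZl//; last 2 first.
- by move=> tau _; rewrite lee_fin ltW// gaussian_gt0.
- by rewrite lee_fin mulr_ge0// normc_ge0.
apply: ge0_le_integral => //.
- by move=> tau _; rewrite lee_fin mulr_ge0// normc_ge0.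
- exact: measurable_funeM.
move=> tau _; rewrite -EFinM lee_fin [leRHS]mulrAC.
by apply: ler_wpM2r; first exact: normc_ge0.
Qed.

Lemma L2tau_ge (r : R -> R) z sigma K : 0 <= K ->
  measurable_fun setT r ->
  (forall tau, sigma <= tau <= sigma + 1 -> K <= `|r tau|) ->
  ((K * normc z)%:E <= L2tau (fun tau => (r tau)%:C * z)%R)%E.
Proof.
move=> K0 mr rK.
have Kz0 : 0 <= K * normc z by rewrite mulr_ge0// normc_ge0.
have -> : (K * normc z)%:E = (((K * normc z) ^+ 2)%:E `^ 2^-1)%E.
  by rewrite poweR_EFin powR12_sqrt ?sqr_ge0// sqrtr_sqr ger0_norm.
have rE tau : normc ((r tau)%:C * z) ^+ 2 = (r tau) ^+ 2 * normc z ^+ 2.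
  by rewrite ComplexField.Normc.normcM normc_real exprMn real_normK// num_real.
have mz : measurable_fun setT (fun tau => (r tau ^+ 2 * normc z ^+ 2)%:E).
  by apply/measurable_EFinP/measurable_funM => //; exact: measurable_funX.
rewrite /L2tau; under eq_integral do rewrite rE.
have r0 tau : (0 <= (r tau ^+ 2 * normc z ^+ 2)%:E)%E.
  by rewrite lee_fin mulr_ge0// sqr_ge0.
apply: gt0_ler_poweR; rewrite ?invr_ge0//.
- by rewrite in_itv/= leey andbT lee_fin sqr_ge0.
- by rewrite in_itv/= leey andbT; apply: integral_ge0 => tau _.
apply: (@le_trans _ _ (\int[mu]_(tau in `[sigma, (sigma + 1)%R])
    (r tau ^+ 2 * normc z ^+ 2)%:E)%E); last first.
  exact: ge0_subset_integral.
have -> : ((K * normc z) ^+ 2)%:E =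
    (\int[mu]_(tau in `[sigma, (sigma + 1)%R]) (((K * normc z) ^+ 2)%:E))%E.
  rewrite integral_cst//= lebesgue_measure_itv/= lte_fin ltrDl ltr01.
  by rewrite -EFinB addrAC subrr add0r mule1.
apply: ge0_le_integral => //.
- by move=> tau _; rewrite lee_fin sqr_ge0.
- exact: measurable_funTS.
move=> tau; rewrite /= in_itv/= => /rK Kr; rewrite lee_fin exprMn.
apply: ler_wpM2r; first exact: sqr_ge0.
by rewrite -(real_normK (num_real (r tau))) lerXn2r ?nnegrE.
Qed.

End SpaceTimeNorms.

(** * Norms of wave packets and necessary conditions *)

Section WaveNorms.
Context {R : realType}.
Implicit Types (a b c d s x sigma tau alpha lambda K A : R) (k : int).
Local Notation mu := (@lebesgue_measure R).
Local Notation normc := ComplexField.Normc.normc.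
Local Open Scope complex_scope.

(** The modulus of the Fourier transform of the wave packet at its own spatial
    frequency, for amplitude 1. *)
Definition wave_profile lambda a sigma tau : R :=
  2 * pi * lambda * gaussian_mass a * gaussian (4 * a)^-1 (sigma - tau).

(** Meant for [N] equal to [L2tau] or [L1tau]. *)
Lemma L2xi_fourier_wave lambda k1 sigma a c d (N : (R -> R[i]) -> \bar R)
    (w : int -> R -> R) : 0 < lambda -> 0 < a ->
  N (fun=> 0) = 0%E -> (forall f, (0 <= N f)%E) ->
  L2xi lambda (fun k => N (fun tau =>
    (w k tau)%:C *
      fourier lambda (wave (freq lambda k1) sigma a c%:P d%:P) k tau)) =
  (((2 * pi * lambda)^-1 `^ 2^-1)%:E *
    N (fun tau => ((w k1 tau * wave_profile lambda a sigma tau)%:C *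
      (c +i* d))%R))%E.
Proof.
move=> l0 a0 N0 Nge0; rewrite (@L2xi_supp1 _ lambda k1)//; last first.
  move=> k kk1; rewrite -[RHS]N0; congr N; apply/funext => tau.
  by rewrite fourier_wave// (negbTE kk1) mulr0.
congr (_ * N _)%E; apply/funext => tau.
by rewrite fourier_wave// eqxx mulrA -rmorphM.
Qed.

Lemma wave_profile_gt0 lambda a sigma tau : 0 < lambda -> 0 < a ->
  0 < wave_profile lambda a sigma tau.
Proof.
move=> l0 a0; rewrite mulr_gt0 ?gaussian_gt0// mulr_gt0 ?gaussian_mass_gt0//.
by rewrite !mulr_gt0// pi_gt0.
Qed.

Lemma measurable_weighted_profile lambda a sigma A x b :
  measurable_fun [set: R]
    (fun tau => A * bracket (tau - x) `^ b * wave_profile lambda a sigma tau).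
Proof.
apply: measurable_funM; apply: measurable_funM => //.
  exact: measurable_bracket_powR.
apply: (measurableT_comp (measurable_gaussian _)).
exact: measurable_funB.
Qed.

(** The weight can be evaluated at the centre of the Gaussian, at the price of
    halving its exponent: Peetre's inequality moves the remaining weight to
    tau - sigma, where [bracket_powR_gaussian_le] absorbs it. *)
Lemma weighted_profile_le lambda a b : 0 < lambda -> 0 < a ->
  exists2 K, 0 < K & forall A x sigma tau, 0 <= A ->
    `|A * bracket (tau - x) `^ b * wave_profile lambda a sigma tau| <=
    K * (A * bracket (sigma - x) `^ b) * gaussian (8 * a)^-1 (tau - sigma).
Proof.
move=> l0 a0.
have e0 : 0 < (8 * a)^-1 by rewrite invr_gt0 mulr_gt0.
pose M := 2 * pi * lambda * gaussian_mass a.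
have M0 : 0 < M by rewrite !mulr_gt0 ?gaussian_mass_gt0 ?pi_gt0.
exists (M * expR (`|b| ^+ 2 / (4 * (8 * a)^-1))).
  by rewrite mulr_gt0// expR_gt0.
move=> A x sigma tau A0; have P0 := ltW (wave_profile_gt0 sigma tau l0 a0).
rewrite ger0_norm; last by rewrite mulr_ge0// mulr_ge0// powR_ge0.
have -> : wave_profile lambda a sigma tau =
    M * gaussian (2 * (8 * a)^-1) (tau - sigma).
  rewrite /wave_profile /M /gaussian; congr (_ * expR _).
  by field; rewrite gt_eqF.
have h1 := peetre (sigma - x) (tau - sigma) b.
rewrite (_ : sigma - x + (tau - sigma) = tau - x) in h1; last by ring.
have h2 := bracket_powR_gaussian_le (tau - sigma) e0 (normr_ge0 b).
set S := bracket (sigma - x) `^ b in h1 *.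
set T := bracket (tau - x) `^ b in h1 *.
set D := bracket (tau - sigma) `^ `|b| in h1 h2.
set g2 := gaussian (2 * _) _ in h2 *; set g := gaussian _ _ in h2 *.
have g20 : 0 < g2 by exact: gaussian_gt0.
have S0 : 0 <= S by exact: powR_ge0.
apply: (@le_trans _ _ (A * (S * D) * (M * g2))).
  apply: ler_wpM2r; first by rewrite mulr_ge0 ?(ltW M0) ?(ltW g20).
  exact: ler_wpM2l.
apply: (@le_trans _ _ (A * S * M * (D * g2))).
  by apply: eq_ler; ring.
apply: (@le_trans _ _ (A * S * M * (expR (`|b| ^+ 2 / (4 * (8 * a)^-1)) * g))).
  by apply: ler_wpM2l => //; rewrite mulr_ge0 ?(ltW M0)// mulr_ge0.
by apply: eq_ler; ring.
Qed.

(** The reverse of [weighted_profile_le] near the centre, from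
    [peetre_lower]. *)
Lemma weighted_profile_ge lambda a b : 0 < lambda -> 0 < a ->
  exists2 K, 0 < K & forall A x sigma tau, 0 <= A ->
    sigma <= tau <= sigma + 1 ->
    K * (A * bracket (sigma - x) `^ b) <=
    `|A * bracket (tau - x) `^ b * wave_profile lambda a sigma tau|.
Proof.
move=> l0 a0.
pose M := 2 * pi * lambda * gaussian_mass a.
have M0 : 0 < M by rewrite !mulr_gt0 ?gaussian_mass_gt0 ?pi_gt0.
exists (2 `^ (- `|b|) * (M * gaussian (4 * a)^-1 1)).
  by rewrite mulr_gt0 ?powR_gt0// mulr_gt0// gaussian_gt0.
move=> A x sigma tau A0 /andP[st ts].
have P0 := ltW (wave_profile_gt0 sigma tau l0 a0).
rewrite [leRHS]ger0_norm; last by rewrite mulr_ge0// mulr_ge0// powR_ge0.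
have h1 := peetre_lower (sigma - x) (tau - sigma) b.
rewrite (_ : sigma - x + (tau - sigma) = tau - x) in h1; last by ring.
have ts1 : `|tau - sigma| <= 1 by rewrite ger0_norm; lra.
have h2 : 2 `^ (- `|b|) <= bracket (tau - sigma) `^ (- `|b|).
  rewrite !powRN lef_pV2 ?posrE ?powR_gt0 ?bracket_gt0//.
  apply: ge0_ler_powR => //; rewrite ?nnegrE ?bracket_ge0//.
  by rewrite /bracket; lra.
have h3 : gaussian (4 * a)^-1 1 <= gaussian (4 * a)^-1 (sigma - tau).
  rewrite ler_expR lerN2 ler_wpM2l ?invr_ge0 ?mulr_ge0 ?(ltW a0)//.
  by rewrite expr1n -(real_normK (num_real (sigma - tau))) distrC exprn_ile1.
have S0 : 0 <= bracket (sigma - x) `^ b by exact: powR_ge0.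
have {}h1 : 2 `^ (- `|b|) * (A * bracket (sigma - x) `^ b) <=
    A * bracket (tau - x) `^ b.
  rewrite mulrCA; apply: ler_wpM2l => //; apply: le_trans h1.
  by rewrite mulrC; apply: ler_wpM2l.
rewrite mulrAC; apply: ler_pM => //.
- by rewrite !mulr_ge0// powR_ge0.
- by rewrite mulr_ge0 ?(ltW M0)// ltW// gaussian_gt0.
- by rewrite /wave_profile -/M; apply: ler_wpM2l => //; exact: ltW.
Qed.

Lemma Xnorm_wave_le lambda alpha s b a : 0 < lambda -> 0 < a ->
  exists2 K, 0 < K & forall k sigma c d,
    (Xnorm lambda alpha s b (wave (freq lambda k) sigma a c%:P d%:P) <=
    (K * (normc (c +i* d) *
      (bracket (freq lambda k) `^ s * modulation lambda alpha k sigma `^ b)))%:E)%E.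
Proof.
move=> l0 a0; have [K K0 HK] := weighted_profile_le b l0 a0.
have e0 : 0 < (8 * a)^-1 by rewrite invr_gt0 mulr_gt0.
pose N := (2 * pi * lambda)^-1 `^ 2^-1.
have N0 : 0 < N by rewrite powR_gt0// invr_gt0 !mulr_gt0// pi_gt0.
pose m := Num.sqrt (gaussian_mass (2 * (8 * a)^-1)).
have m0 : 0 < m by rewrite sqrtr_gt0 gaussian_mass_gt0// mulr_gt0.
exists (N * K * m); first by rewrite !mulr_gt0.
move=> k sigma c d; rewrite /Xnorm L2xi_fourier_wave//; last 2 first.
- exact: L2tau0.
- exact: L2tau_ge0.
have B0 : 0 <= bracket (freq lambda k) `^ s by exact: powR_ge0.
have AB0 : 0 <= K * (bracket (freq lambda k) `^ s *
    modulation lambda alpha k sigma `^ b).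
  by rewrite !mulr_ge0// ?(ltW K0)// powR_ge0.
have := L2tau_le (c +i* d) e0 AB0
  (measurable_weighted_profile lambda a sigma (bracket (freq lambda k) `^ s)
     (alpha * freq lambda k ^+ 3) b) (fun tau => HK _ _ sigma tau B0).
have N0e : (0 <= N%:E)%E by rewrite lee_fin ltW.
move=> /(lee_wpmul2l N0e) h.
apply: (le_trans h).
rewrite -EFinM lee_fin; apply: eq_ler.
by rewrite -/m; ring.
Qed.

Lemma Xnorm_wave_ge lambda alpha s b a : 0 < lambda -> 0 < a ->
  exists2 K, 0 < K & forall k sigma c d,
    ((K * (normc (c +i* d) *
      (bracket (freq lambda k) `^ s * modulation lambda alpha k sigma `^ b)))%:E
    <= Xnorm lambda alpha s b (wave (freq lambda k) sigma a c%:P d%:P))%E.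
Proof.
move=> l0 a0; have [K K0 HK] := weighted_profile_ge b l0 a0.
pose N := (2 * pi * lambda)^-1 `^ 2^-1.
have N0 : 0 < N by rewrite powR_gt0// invr_gt0 !mulr_gt0// pi_gt0.
exists (N * K); first by rewrite !mulr_gt0.
move=> k sigma c d; rewrite /Xnorm L2xi_fourier_wave//; last 2 first.
- exact: L2tau0.
- exact: L2tau_ge0.
have B0 : 0 <= bracket (freq lambda k) `^ s by exact: powR_ge0.
have AB0 : 0 <= K * (bracket (freq lambda k) `^ s *
    modulation lambda alpha k sigma `^ b).
  by rewrite !mulr_ge0// ?(ltW K0)// powR_ge0.
have := L2tau_ge (c +i* d) AB0
  (measurable_weighted_profile lambda a sigma (bracket (freq lambda k) `^ s)
     (alpha * freq lambda k ^+ 3) b) (fun tau => HK _ _ sigma tau B0).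
have N0e : (0 <= N%:E)%E by rewrite lee_fin ltW.
move=> /(lee_wpmul2l N0e) h.
apply: le_trans _ h.
rewrite -EFinM lee_fin; apply: eq_ler.
by ring.
Qed.

(** The weight does not depend on tau: it is the case b = 0 of
    [weighted_profile_le]. *)
Lemma L2xi_L1tau_wave_le lambda s a : 0 < lambda -> 0 < a ->
  exists2 K, 0 < K & forall k sigma c d,
    (L2xi lambda (fun k1 => L1tau (fun tau =>
       ((bracket (freq lambda k1) `^ s)%:C *
         fourier lambda (wave (freq lambda k) sigma a c%:P d%:P) k1 tau)%R)) <=
    (K * (normc (c +i* d) * bracket (freq lambda k) `^ s))%:E)%E.
Proof.
move=> l0 a0; have [K K0 HK] := weighted_profile_le 0 l0 a0.
have e0 : 0 < (8 * a)^-1 by rewrite invr_gt0 mulr_gt0.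
pose N := (2 * pi * lambda)^-1 `^ 2^-1.
have N0 : 0 < N by rewrite powR_gt0// invr_gt0 !mulr_gt0// pi_gt0.
have m0 := gaussian_mass_gt0 e0; set m := gaussian_mass _ in m0.
exists (N * K * m); first by rewrite !mulr_gt0.
move=> k sigma c d.
rewrite (@L2xi_fourier_wave lambda k sigma a c d (@L1tau R)
  (fun k1 _ => bracket (freq lambda k1) `^ s))//; last 2 first.
- exact: L1tau0.
- exact: L1tau_ge0.
have B0 : 0 <= bracket (freq lambda k) `^ s by exact: powR_ge0.
have AB0 : 0 <= K * (bracket (freq lambda k) `^ s * bracket (sigma - 0) `^ 0).
  by rewrite !mulr_ge0// ?(ltW K0)// powR_ge0.
have := L1tau_le (c +i* d) e0 AB0
  (measurable_weighted_profile lambda a sigma (bracket (freq lambda k) `^ s)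
     0 0) (fun tau => HK _ _ sigma tau B0).
have N0e : (0 <= N%:E)%E by rewrite lee_fin ltW.
move=> /(lee_wpmul2l N0e) h.
(* The weight of order 0 left by the bound is the constant 1. *)
under eq_fun do rewrite -[bracket (freq lambda k) `^ s]mulr1.
rewrite powRr0 mulr1 in h.
move: h; under eq_fun do rewrite powRr0; move=> h.
apply: (le_trans h).
rewrite -EFinM lee_fin; apply: eq_ler.
by rewrite -/m; ring.
Qed.

(** The second part of the norm loses the factor <sigma - alpha xi^3>^(1/2),
    which is at least 1, so both parts have the bound of the first. *)
Lemma Ynorm_wave_le lambda alpha s a : 0 < lambda -> 0 < a ->
  exists2 K, 0 < K & forall k sigma c d,
    (Ynorm lambda alpha s (wave (freq lambda k) sigma a c%:P d%:P) <=
    (K * (normc (c +i* d) * (bracket (freq lambda k) `^ s *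
      modulation lambda alpha k sigma `^ 2^-1)))%:E)%E.
Proof.
move=> l0 a0; have [K1 K10 H1] := Xnorm_wave_le alpha s 2^-1 l0 a0.
have [K2 K20 H2] := L2xi_L1tau_wave_le s l0 a0.
exists (K1 + K2); first by rewrite addr_gt0.
move=> k sigma c d; apply: (le_trans (leeD (H1 _ _ _ _) (H2 _ _ _ _))).
rewrite -EFinD lee_fin mulrDl lerD2l; apply: ler_wpM2l; first exact: ltW.
apply: ler_wpM2l; first exact: normc_ge0.
rewrite ler_peMr ?powR_ge0//.
have {1}<- : (1 : R) `^ 2^-1 = 1 by rewrite powR1.
by apply: ge0_ler_powR;
  rewrite ?invr_ge0 ?nnegrE ?bracket_ge0 ?bracket_ge1.
Qed.

Lemma Xnorm_le_Znorm lambda alpha s (u : R -> R -> R[i]) :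
  (Xnorm lambda alpha s (- 2^-1) u <= Znorm lambda alpha s u)%E.
Proof. by rewrite /Znorm leeDl// poweR_ge0. Qed.

Lemma partial_x_wave_mul lambda k1 k2 sigma1 sigma2 a :
  partial_x (fun x t => wave (freq lambda k1) sigma1 a 1%:P 0%:P x t *
    wave (freq lambda k2) sigma2 a 1%:P 0%:P x t) =
  wave (freq lambda (k1 + k2)) (sigma1 + sigma2) (2 * a)
    0%:P (freq lambda (k1 + k2))%:P.
Proof.
rewrite (_ : (fun x t => _) = wave (freq lambda k1 + freq lambda k2)
    (sigma1 + sigma2) (2 * a) 1 0); last first.
  by apply/funext => x; apply/funext => t; rewrite polyC1 polyC0 wave_mul.
rewrite partial_x_wave scaler0 oppr0 alg_polyC.
by rewrite /freq intrD (mulrDl k1%:~R) polyC0.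
Qed.

(** What a bilinear estimate says about wave packets, up to constants. *)
Definition wave_estimate lambda alpha s b (U : set (R -> R -> R[i])) : Prop :=
  exists C, forall k1 k2 sigma1 sigma2,
    U (wave (freq lambda k1) sigma1 1 1%:P 0%:P) ->
    let xi1 := freq lambda k1 in let xi2 := freq lambda k2 in
    let xi := freq lambda (k1 + k2) in
    is_true (`|xi| * bracket xi `^ s *
      bracket (sigma1 + sigma2 - alpha * xi ^+ 3) `^ (b - 1) <=
    C * (bracket xi1 `^ s * bracket (sigma1 - xi1 ^+ 3) `^ b *
      (bracket xi2 `^ s * bracket (sigma2 - alpha * xi2 ^+ 3) `^ b))).

(** Common to both estimates: [NU] and [NV] are the norms of the factors and
    [NW] that of the derivative of their product, of which only the size on
    wave packets matters. *)
Lemma wave_estimate_norms lambda alpha s b U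
    (NU NV NW : (R -> R -> R[i]) -> \bar R) : 0 < lambda ->
  (exists2 K, 0 < K & forall k sigma c d,
    (NU (wave (freq lambda k) sigma 1 c%:P d%:P) <=
      (K * (normc (c +i* d) * (bracket (freq lambda k) `^ s *
        modulation lambda 1 k sigma `^ b)))%:E)%E) ->
  (exists2 K, 0 < K & forall k sigma c d,
    (NV (wave (freq lambda k) sigma 1 c%:P d%:P) <=
      (K * (normc (c +i* d) * (bracket (freq lambda k) `^ s *
        modulation lambda alpha k sigma `^ b)))%:E)%E) ->
  (exists2 K, 0 < K & forall k sigma c d,
    ((K * (normc (c +i* d) * (bracket (freq lambda k) `^ s *
        modulation lambda alpha k sigma `^ (b - 1))))%:E <=
      NW (wave (freq lambda k) sigma (2 * 1) c%:P d%:P))%E) ->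
  (forall u, 0 <= NU u)%E -> (forall u, 0 <= NV u)%E ->
  (exists C : R, forall u v, schwartz lambda u -> schwartz lambda v -> U u ->
    (NW (partial_x (fun x t => (u x t * v x t)%R)) <=
      C%:E * (NU u * NV v))%E) ->
  wave_estimate lambda alpha s b U.
Proof.
move=> l0 [K1 K10 H1] [K2 K20 H2] [K3 K30 H3] NU0 NV0 [C HC].
exists (K3^-1 * (`|C| * K1 * K2)) => k1 k2 sigma1 sigma2 Uw xi1 xi2 xi.
have normc1 : normc (1 +i* 0 : R[i]) = 1 by rewrite (normc_real 1) normr1.
have normci (y : R) : normc (0 +i* y) = `|y|.
  by rewrite /= expr0n add0r sqrtr_sqr.
have := HC _ _ (schwartz_wave k1 sigma1 1%:P 0%:P l0 ltr01)
  (schwartz_wave k2 sigma2 1%:P 0%:P l0 ltr01) Uw.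
rewrite partial_x_wave_mul => {}HC.
have {}H3 := H3 (k1 + k2) (sigma1 + sigma2) 0 xi.
rewrite normci in H3.
have {}H1 := H1 k1 sigma1 1 0; have {}H2 := H2 k2 sigma2 1 0.
rewrite normc1 mul1r in H1; rewrite normc1 mul1r in H2.
have := le_trans H3 HC => {}HC.
have h : (C%:E * (NU (wave (freq lambda k1) sigma1 1 1%:P 0%:P) *
    NV (wave (freq lambda k2) sigma2 1 1%:P 0%:P)) <=
  `|C|%:E * ((K1 * (bracket xi1 `^ s * modulation lambda 1 k1 sigma1 `^ b))%:E *
   (K2 * (bracket xi2 `^ s * modulation lambda alpha k2 sigma2 `^ b))%:E))%E.
  apply: (@le_trans _ _ (`|C|%:E *
    (NU (wave (freq lambda k1) sigma1 1 1%:P 0%:P) *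
    NV (wave (freq lambda k2) sigma2 1 1%:P 0%:P)))%E).
    by apply: lee_wpmul2r; rewrite ?mule_ge0// lee_fin ler_norm.
  by apply: lee_wpmul2l => //; apply: lee_pmul.
have {h} := le_trans HC h; rewrite -!EFinM lee_fin => h.
rewrite /modulation mul1r in h.
rewrite -[leRHS]mulrA ler_pdivlMl// -[X in K3 * X]mulrA; apply: (le_trans h).
by apply: eq_ler; ring.
Qed.

Lemma X_estimate_wave lambda alpha s b U : 0 < lambda ->
  X_estimate lambda alpha s b U -> wave_estimate lambda alpha s b U.
Proof.
move=> l0; apply: wave_estimate_norms => //.
- exact: Xnorm_wave_le.
- exact: Xnorm_wave_le.
- by apply: Xnorm_wave_ge => //; rewrite mulr1.
- by move=> u; exact: poweR_ge0.
- by move=> u; exact: poweR_ge0.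
Qed.

Lemma YZ_estimate_wave lambda alpha s U : 0 < lambda ->
  YZ_estimate lambda alpha s U -> wave_estimate lambda alpha s 2^-1 U.
Proof.
move=> l0; apply: wave_estimate_norms => //.
- exact: Ynorm_wave_le.
- exact: Ynorm_wave_le.
- have [//||K K0 HK] := @Xnorm_wave_ge lambda alpha s (2^-1 - 1) (2 * 1).
    by rewrite mulr1.
  exists K => // k sigma c d; apply: (le_trans (HK _ _ _ _)).
  rewrite (_ : 2^-1 - 1 = - 2^-1); last by field.
  exact: Xnorm_le_Znorm.
- by move=> u; rewrite adde_ge0// poweR_ge0.
- by move=> u; rewrite adde_ge0// poweR_ge0.
Qed.

Lemma mean0_wave lambda k sigma a c d : 0 < lambda -> 0 < a -> k != 0 ->
  mean0 lambda (wave (freq lambda k) sigma a c%:P d%:P).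
Proof.
move=> l0 a0 k0; apply/aeW => tau.
by rewrite fourier_wave// eq_sym (negbTE k0).
Qed.

End WaveNorms.

(** * Diophantine approximation *)

Section Diophantine.
Context {R : realType}.
Implicit Types (rho beta nu s eps : R) (m n : int) (N : nat).

(** The exponent 2 + beta is attained for arbitrarily large denominators. *)
Definition approximable rho beta : Prop := forall N, exists m n,
  [/\ n != 0, (N <= `|n|)%N &
      `|rho - m%:~R / n%:~R| <= `|n%:~R : R| `^ (- 2 - beta)].

Lemma normz_ge1 n : n != 0 -> 1 <= `|n%:~R : R|.
Proof. by move=> n0; rewrite -intr_norm -[leLHS]/(1%:~R) ler_int; lia. Qed.

Lemma approximable_rational rho beta : rational rho -> approximable rho beta.
Proof.
move=> [q _ <-] N; exists (numq q * N.+1%:Z), (denq q * N.+1%:Z).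
have d0 : denq q != 0 by exact: denq_neq0.
split; first by rewrite mulf_neq0.
  rewrite abszM; apply: (@leq_trans (1 * N.+1)); first by rewrite mul1n.
  by rewrite leq_mul2r lt0n absz_eq0 d0 orbT.
rewrite /ratr !intrM -mulf_div divff ?pnatr_eq0// mulr1 subrr normr0.
exact: powR_ge0.
Qed.

(** All fractions with denominator at most N are fractions over N!, so the
    distance to the nearest multiple of 1 / N! is a lower bound. *)
Lemma irrational_distance rho N : ~ rational rho ->
  exists2 delta : R, 0 < delta &
  forall m n, n != 0 -> (`|n| <= N)%N -> delta <= `|rho - m%:~R / n%:~R|.
Proof.
move=> irr; pose q : R := N`!%:R.
have q0 : 0 < q by rewrite ltr0n fact_gt0.
pose f := Num.floor (q * rho).
have /andP[f1 f2] := floor_itv (q * rho).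
have {}f1 : f%:~R < q * rho.
  rewrite lt_neqAle f1 andbT; apply/eqP => fE; apply: irr.
  exists (f%:~R / N`!%:R) => //.
  rewrite fmorph_div/= ratr_int ratr_nat fE -/q.
  by rewrite mulrC mulKf ?gt_eqF.
(* distance from q rho to the nearer of its two neighbouring integers *)
exists (Num.min (q * rho - f%:~R) ((f + 1)%:~R - q * rho) / q).
  by rewrite divr_gt0// lt_min !subr_gt0 f1.
move=> m n n0 nN.
have /dvdnP[r rE] : (`|n| %| N`!)%N by rewrite dvdn_fact// nN lt0n absz_eq0 n0.
pose M : int := m * sgz n * r%:Z.
have nR : n%:~R != 0 :> R by rewrite intr_eq0.
have -> : rho - m%:~R / n%:~R = (q * rho - M%:~R) / q.
  have -> : (M%:~R : R) = m%:~R / n%:~R * q.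
    have -> : q = r%:R * (sgz n)%:~R * n%:~R.
      by rewrite /q rE natrM (pmulrn 1 `|n|) abszEsg intrM mulrA.
    by rewrite /M !intrM; field.
  by field; rewrite gt_eqF.
rewrite normf_div (gtr0_norm q0) ler_pM2r ?invr_gt0// ge_min.
have [Mf|Mf] := leP M f.
  rewrite ger0_norm; first by rewrite lerD2l lerN2 ler_int Mf.
  by rewrite subr_ge0 (le_trans _ (ltW f1))// ler_int.
apply/orP; right; have {}Mf : (f + 1)%:~R <= M%:~R :> R by rewrite ler_int; lia.
by rewrite distrC ger0_norm ?subr_ge0 ?(le_trans (ltW f2))// lerD2r.
Qed.

(** For an irrational number, good approximations that get arbitrarily close
    must have unbounded denominators. *)
Lemma approximable_irrational rho beta : ~ rational rho ->
  (forall eps, 0 < eps -> exists m n, [/\ n != 0,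
    `|rho - m%:~R / n%:~R| < eps &
    `|rho - m%:~R / n%:~R| <= `|n%:~R : R| `^ (- 2 - beta)]) ->
  approximable rho beta.
Proof.
move=> irr H N; have [delta delta0 Hd] := irrational_distance N irr.
have [m [n [n0 ne nb]]] := H _ delta0; exists m, n; split=> //.
rewrite leqNgt; apply/negP => /ltnW /(Hd m n n0).
by rewrite leNgt ne.
Qed.

(** Failing to be of type nu with the constant min(eps, 1) gives at once
    closeness eps and the exponent 2 + nu. *)
Lemma approximable_not_of_type rho nu : ~ rational rho -> 0 < nu ->
  ~ of_type rho nu -> approximable rho nu.
Proof.
move=> irr nu0 nt; apply: approximable_irrational => // eps eps0.
have [//|/forallNP H] := pselect (exists m n, [/\ n != 0,
  `|rho - m%:~R / n%:~R| < eps &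
  `|rho - m%:~R / n%:~R| <= `|n%:~R : R| `^ (- 2 - nu)]).
exfalso; apply: nt; exists (Num.min eps 1); first by rewrite lt_min eps0 ltr01.
move=> m n n0; rewrite leNgt; apply/negP => lt.
apply: (H m); exists n.
have p0 : 0 <= `|n%:~R : R| `^ (- 2 - nu) by exact: powR_ge0.
have p1 : `|n%:~R : R| `^ (- 2 - nu) <= 1.
  rewrite -[leRHS](powRr0 `|n%:~R : R|); apply: ler_powR; last by lra.
  exact: normz_ge1.
split=> //.
  apply: (lt_le_trans lt); rewrite -[leRHS]mulr1; apply: ler_pM => //.
    by rewrite le_min ler01 ltW.
  by rewrite ge_min lexx.
apply: (le_trans (ltW lt)); rewrite ler_piMl//.
by rewrite ge_min lexx orbT.
Qed.

(** Pigeonhole: among the N + 1 fractional parts of i rho, 0 <= i <= N, two lie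
    in the same of the N intervals of length 1 / N. *)
Lemma dirichlet rho N : (0 < N)%N -> exists m n,
  [/\ n != 0, (`|n| <= N)%N & `|n%:~R * rho - m%:~R| < N%:R^-1].
Proof.
move=> N0; have NR : (0 : R) < N%:R by rewrite ltr0n.
pose fr (i : nat) : R := i%:R * rho - (Num.floor (i%:R * rho))%:~R.
have fr0 i : 0 <= fr i by rewrite subr_ge0 floor_le.
have fr1 i : fr i < 1.
  have /andP[_] := floor_itv (i%:R * rho).
  by rewrite /fr ltrBlDl intrD.
pose g i := Num.floor (N%:R * fr i).
have g0 i : 0 <= g i by rewrite floor_ge0 mulr_ge0// ltW.
have gN i : (`|g i| < N)%N.
  have : g i < N%:Z.
    rewrite -(@ltr_int R) (le_lt_trans (floor_le _))//.
    by rewrite -[ltRHS]mulr1 ltr_pM2l.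
  by have := g0 i; lia.
pose h (i : 'I_N.+1) : 'I_N := Ordinal (gN i).
have /injectivePn[i [j ij hij]] : ~~ injectiveb h.
  apply/negP => /injectiveP /leq_card; rewrite !card_ord; lia.
have gij : g i = g j.
  have := congr1 val hij; rewrite /=.
  by have := g0 i; have := g0 j; lia.
exists (Num.floor (i%:R * rho) - Num.floor (j%:R * rho)), (i%:Z - j%:Z).
split.
- by move: ij; rewrite -val_eqE /=; lia.
- by have := ltn_ord i; have := ltn_ord j; lia.
have -> : (i%:Z - j%:Z)%:~R * rho -
    (Num.floor (i%:R * rho) - Num.floor (j%:R * rho))%:~R = fr i - fr j.
  by rewrite !intrB /fr -!pmulrn; ring.
have /andP[i1 i2] := floor_itv (N%:R * fr i).
have /andP[j1 j2] := floor_itv (N%:R * fr j).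
rewrite -/(g i) in i1 i2; rewrite -/(g j) -gij in j1 j2.
rewrite -(ltr_pM2l NR) divff ?gt_eqF// -[X in X * _](gtr0_norm NR) -normrM.
move: i2 j2; rewrite intrD => i2 j2.
by rewrite mulrBr ltr_norml; apply/andP; split; lra.
Qed.

Lemma approximable_dirichlet rho : ~ rational rho -> approximable rho 0.
Proof.
move=> irr; apply: approximable_irrational => // eps eps0.
pose N := (Num.bound eps^-1).+1.
have NR : (0 : R) < N%:R by rewrite ltr0n.
have Ne : N%:R^-1 < eps.
  rewrite -[ltRHS]invrK ltf_pV2 ?posrE ?invr_gt0//.
  rewrite (lt_le_trans (archi_boundP _)) ?invr_ge0 ?(ltW eps0)//.
  by rewrite ler_nat.
have [m [n [n0 nN H]]] := dirichlet rho (ltn0Sn (Num.bound eps^-1)).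
have n1 := normz_ge1 n0.
have n0R : 0 < `|n%:~R : R| by exact: lt_le_trans ltr01 n1.
have nR : n%:~R != 0 :> R by rewrite intr_eq0.
have E : `|rho - m%:~R / n%:~R| = `|n%:~R * rho - m%:~R| / `|n%:~R|.
  by rewrite -normf_div; congr (`| _ |); field.
exists m, n; split=> //.
  rewrite E (le_lt_trans _ Ne)// ler_pdivrMr//.
  by rewrite (le_trans (ltW H))// ler_peMr// invr_ge0 ltW.
have -> : `|n%:~R : R| `^ (- 2 - 0) = `|n%:~R|^-1 / `|n%:~R|.
  by rewrite subr0 powR_invn ?normr_ge0// -invfM expr2.
rewrite E ler_pM2r ?invr_gt0// (le_trans (ltW H))//.
rewrite lef_pV2 ?posrE// -intr_norm -[leRHS]/((N : int)%:~R) ler_int.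
by rewrite /N; lia.
Qed.

(** In the irrational case with s >= 1/2, beta is half-way between 2s - 1 and
    the type index, or 1 if that is smaller; lying below the infimum of the
    types, it is not one of them. *)
Lemma approximable_type_index rho s : s < 1 ->
  (s%:E < 2^-1%:E + 2^-1%:E * type_index rho)%E ->
  exists beta,
    [/\ 0 <= beta, beta <= 1, 2 * s - 1 < beta & approximable rho beta].
Proof.
move=> s1; rewrite /type_index; case: ifPn => [/set_mem rat _|/negP irr].
  exists 1; split => //; first by lra.
  exact: approximable_rational.
have {}irr : ~ rational rho by move=> h; apply: irr; rewrite inE.
set S := [set _ | _ in _] => sS.
have [s2|s2] := ltP s 2^-1.
  by exists 0; split => //; [lra|exact: approximable_dirichlet].
suff [beta [b0 b1 sb bS]] : exists beta,
    [/\ 0 < beta, beta <= 1, 2 * s - 1 < beta & (beta%:E < ereal_inf S)%E].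
  exists beta; split => //; first exact: ltW.
  apply: approximable_not_of_type => // bt.
  have : (ereal_inf S <= beta%:E)%E by apply: ereal_inf_lbound; exists beta.
  by rewrite leNgt bS.
move: sS; case: (ereal_inf S) => [r| |] sS.
- have {sS} : s < 2^-1 + 2^-1 * r by move: sS; rewrite -EFinM -EFinD lte_fin.
  move=> sr; exists (Num.min 1 (s - 2^-1 + r / 2)); split.
  + by rewrite lt_min; lra.
  + by rewrite ge_min lexx.
  + by rewrite lt_min; lra.
  + by rewrite lte_fin gt_min; apply/orP; right; lra.
- by exists 1; split => //; [lra|exact: ltry].
- by move: sS; rewrite mulrNy gtr0_sg// mul1e.
Qed.

End Diophantine.

(** * The resonance function and the failure of the estimates *)

Section Failure.
Context {R : realType}.
Implicit Types (s b alpha lambda beta d e x y c D : R) (m n k : int).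

Lemma bracket0 : bracket (0 : R) = 1.
Proof. by rewrite /bracket normr0 addr0. Qed.

Lemma freq0 lambda : freq lambda 0 = 0.
Proof. by rewrite /freq mul0r. Qed.

(** A factor u of frequency 0 does not move v in frequency, so nothing
    compensates the derivative. *)
Lemma not_wave_estimate_setT lambda alpha s b : 0 < lambda ->
  ~ wave_estimate lambda alpha s b setT.
Proof.
move=> l0 [C HC]; pose n := Num.bound (`|C| * lambda).
have nC : `|C| * lambda < n%:R by rewrite archi_boundP// mulr_ge0// ltW.
have := HC 0 n%:Z 0 (alpha * freq lambda n%:Z ^+ 3) I.
rewrite /= !add0r freq0 expr0n /= !subrr oppr0 bracket0 !powR1 !mulr1 !mul1r.
rewrite ler_pM2r ?bracket_powR_gt0// => /le_trans/(_ (ler_norm C)).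
rewrite /freq normrM normfV (gtr0_norm l0) ler_pdivrMr// -pmulrn normr_nat.
by rewrite leNgt nC.
Qed.

(** The modulation H is first put on the product, with exponent b - 1, and then
    on u, with exponent b; in the product of the two inequalities the powers of
    <H> differ by exactly one. *)
Lemma wave_estimate_resonance lambda alpha s b : 0 < lambda ->
  wave_estimate lambda alpha s b (mean0 lambda) ->
  exists C : R, forall k1 k2, k1 != 0 ->
    let xi1 := freq lambda k1 in let xi2 := freq lambda k2 in
    let xi := freq lambda (k1 + k2) in
    is_true ((`|xi| * bracket xi `^ s) ^+ 2 <=
      C * (bracket xi1 `^ s * bracket xi2 `^ s) ^+ 2 *
      bracket (xi1 ^+ 3 + alpha * xi2 ^+ 3 - alpha * xi ^+ 3)).
Proof.
move=> l0 [C HC]; exists (C ^+ 2) => k1 k2 k10 xi1 xi2 xi.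
set H := xi1 ^+ 3 + alpha * xi2 ^+ 3 - alpha * xi ^+ 3.
have mw sigma := mean0_wave sigma 1 0 l0 ltr01 k10.
have h1 := HC k1 k2 (xi1 ^+ 3) (alpha * xi2 ^+ 3) (mw _).
have h2 := HC k1 k2 (xi1 ^+ 3 - H) (alpha * xi2 ^+ 3) (mw _).
rewrite /= -/xi1 -/xi2 -/xi -/H !subrr bracket0 !powR1 !mulr1 in h1.
rewrite /= -/xi1 -/xi2 -/xi !subrr bracket0 !powR1 !mulr1 in h2.
rewrite (_ : xi1 ^+ 3 - H + alpha * xi2 ^+ 3 - alpha * xi ^+ 3 = 0) in h2;
  last by rewrite /H; ring.
rewrite (_ : xi1 ^+ 3 - H - xi1 ^+ 3 = - H) in h2; last by ring.
rewrite bracketN bracket0 powR1 mulr1 in h2.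
set A := `|xi| * bracket xi `^ s in h1 h2 *.
set B1 := bracket xi1 `^ s in h1 h2 *; set B2 := bracket xi2 `^ s in h1 h2 *.
have A0 : 0 <= A by rewrite mulr_ge0// powR_ge0.
have HE : bracket H `^ b = bracket H `^ (b - 1) * bracket H.
  rewrite -[X in _ * X]powRr1 ?bracket_ge0// -powRD ?subrK//.
  by rewrite (gt_eqF (bracket_gt0 H)) implybT.
have P0 : 0 < bracket H `^ (b - 1) by exact: bracket_powR_gt0.
rewrite HE in h2; rewrite -(ler_pM2r P0).
have := ler_pM _ _ h1 h2; rewrite mulr_ge0 ?(ltW P0)// => /(_ isT A0) h.
rewrite (_ : A ^+ 2 * _ = A * bracket H `^ (b - 1) * A); last by ring.
by rewrite (le_trans h)// le_eqVlt; apply/orP; left; apply/eqP; ring.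
Qed.

Lemma powR_comparable c D y x s : 0 < c -> 0 < x -> c * x <= y -> y <= D * x ->
  y `^ s <= (c `^ s + D `^ s) * x `^ s.
Proof.
move=> c0 x0 cy yD; have y0 : 0 < y by apply: lt_le_trans cy; rewrite mulr_gt0.
have D0 : 0 < D by rewrite -(pmulr_lgt0 _ x0) (lt_le_trans y0).
have cs := powR_ge0 c s; have Ds := powR_ge0 D s; have xs := powR_ge0 x s.
rewrite mulrDl; have [s0|s0] := leP 0 s.
  apply: (@le_trans _ _ ((D * x) `^ s)).
    apply: ge0_ler_powR => //; rewrite nnegrE; first exact: ltW.
    exact/ltW/(lt_le_trans y0).
  by rewrite powRM ?(ltW D0) ?(ltW x0)// lerDr mulr_ge0.
apply: (@le_trans _ _ ((c * x) `^ s)).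
  rewrite -(opprK s) !(powRN _ (- s)) lef_pV2 ?posrE ?powR_gt0 ?mulr_gt0//.
  apply: ge0_ler_powR => //; rewrite ?nnegrE ?oppr_ge0; try exact: ltW.
  by rewrite mulr_ge0// ltW.
by rewrite powRM ?(ltW c0) ?(ltW x0)// lerDl mulr_ge0.
Qed.

Lemma powR_bounded_exponent_le0 eps C : 
  (forall M : R, exists2 B, M <= B & B `^ eps <= C) -> eps <= 0.
Proof.
move=> H; rewrite leNgt; apply/negP => e0.
have [B MB BC] := H ((`|C| + 1) `^ eps^-1).
have C1 : 0 <= `|C| + 1 by rewrite addr_ge0.
have : (`|C| + 1) `^ eps^-1 `^ eps <= B `^ eps.
  apply: ge0_ler_powR; rewrite ?nnegrE ?(ltW e0) ?powR_ge0//.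
  exact: le_trans (powR_ge0 _ _) MB.
rewrite -powRrM mulVf ?gt_eqF// powRr1// => /le_trans/(_ BC).
by have := ler_norm C; lra.
Qed.

(** The resonance function divided by its root x1 = 0 is a quadratic form whose
    roots x1 / x are d1 and d2. *)
Lemma resonance_quadratic alpha x1 x : 0 < alpha -> alpha < 1 ->
  (1 - alpha) * x1 ^+ 2 + 3 * alpha * x * x1 - 3 * alpha * x ^+ 2 =
  (1 - alpha) * (x1 - d1 alpha * x) * (x1 - d2 alpha * x).
Proof.
move=> a0 a1; rewrite /d1 /d2; set r := Num.sqrt _.
have rE : r ^+ 2 = 3 * alpha * (4 - alpha).
  by rewrite sqr_sqrtr// !mulr_ge0//; lra.
transitivity (((2 * (1 - alpha) * x1 + 3 * alpha * x) ^+ 2 -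
    r ^+ 2 * x ^+ 2) / (4 * (1 - alpha))).
  by rewrite rE; field; lra.
by field; lra.
Qed.

Lemma resonance_factor alpha x1 x : 0 < alpha -> alpha < 1 ->
  x1 ^+ 3 + alpha * (x - x1) ^+ 3 - alpha * x ^+ 3 =
  (1 - alpha) * x1 * (x1 - d1 alpha * x) * (x1 - d2 alpha * x).
Proof.
move=> a0 a1; transitivity
  (x1 * ((1 - alpha) * x1 ^+ 2 + 3 * alpha * x * x1 - 3 * alpha * x ^+ 2)).
  by ring.
by rewrite resonance_quadratic//; ring.
Qed.

(** The quadratic form of [resonance_quadratic] at x = 1 takes the values
    - 3 alpha at 0 and 1 - alpha at 1. *)
Lemma resonance_root_neq alpha d : 0 < alpha -> alpha < 1 ->
  d = d1 alpha \/ d = d2 alpha -> d != 0 /\ d != 1.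
Proof.
move=> a0 a1 dE; have := resonance_quadratic d 1 a0 a1.
have -> : (1 - alpha) * (d - d1 alpha * 1) * (d - d2 alpha * 1) = 0.
  by case: dE => ->; rewrite !mulr1 subrr !(mulr0, mul0r).
by move=> E; split; apply/eqP => dz; move: E; rewrite dz; lra.
Qed.

(** Frequencies comparable to x have comparable brackets, hence comparable
    powers of them for either sign of s. *)
Lemma bracket_powR_scale_le c D t x s : 0 < c -> 1 <= `|x| ->
  c <= `|t| -> `|t| <= D ->
  bracket (t * x) `^ s <= ((c / 2) `^ s + (D + 1) `^ s) * bracket x `^ s.
Proof.
move=> c0 x1 ct tD; have x0 : 0 <= `|x| by [].
have cx : c * `|x| <= `|t| * `|x| by exact: ler_wpM2r.
have Dx : `|t| * `|x| <= D * `|x| by exact: ler_wpM2r.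
apply: powR_comparable.
- by rewrite divr_gt0.
- exact: bracket_gt0.
- have : c * 1 <= c * `|x| by rewrite ler_pM2l.
  by rewrite /bracket normrM; lra.
- have D0 : 0 <= D by exact: le_trans tD.
  by rewrite /bracket normrM; lra.
Qed.

(** With x1 = rho x, the resonance function is x^3 (rho - d) times factors that
    stay bounded, and |x|^3 |rho - d| <= |x|^(1 - beta). *)
Lemma bracket_resonance_le alpha beta rho d e x D :
  0 <= 1 - alpha -> beta <= 1 -> 1 <= `|x| -> `|rho| <= D ->
  `|rho - d| <= `|x| `^ (- 2 - beta) ->
  bracket ((1 - alpha) * (rho * x) * (rho * x - d * x) * (rho * x - e * x)) <=
  (1 + (1 - alpha) * D * (D + `|e|)) * bracket x `^ (1 - beta).
Proof.
move=> a10 b1 x1 rD rd.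
have D0 : 0 <= D by exact: le_trans rD.
have x0 : 0 < `|x| by exact: lt_le_trans x1.
have b10 : 0 <= 1 - beta by rewrite subr_ge0.
have Q1 : 1 <= bracket x `^ (1 - beta).
  rewrite -[leLHS](powRr0 (bracket x)).
  by apply: ler_powR; first exact: bracket_ge1.
have xQ : `|x| ^+ 3 * `|x| `^ (- 2 - beta) <= bracket x `^ (1 - beta).
  rewrite -powR_mulrn// -powRD; last by rewrite (gt_eqF x0) implybT.
  rewrite (_ : 3 + (- 2 - beta) = 1 - beta); last by ring.
  by apply: ge0_ler_powR; rewrite ?nnegrE ?bracket_ge0// lerDr.
have -> : (1 - alpha) * (rho * x) * (rho * x - d * x) * (rho * x - e * x) =
  (1 - alpha) * rho * (rho - e) * (x ^+ 3 * (rho - d)) by ring.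
rewrite /bracket -/(bracket x) normrM (normrM (x ^+ 3)) normrX 2!normrM.
rewrite (ger0_norm a10) [leRHS]mulrDl mul1r lerD//; apply: ler_pM.
- by rewrite !mulr_ge0.
- by rewrite mulr_ge0// exprn_ge0.
- apply: ler_pM => //; first by rewrite mulr_ge0.
    exact: ler_wpM2l.
  by rewrite (le_trans (ler_normB _ _))// lerD2r.
- by apply: le_trans xQ; apply: ler_wpM2l => //; exact: exprn_ge0.
Qed.

(** Solving the resonance inequality for <x>: the powers are 2 + 2s on the left
    and 4s + 1 - beta on the right. *)
Lemma bracket_powR_bound s beta K L C x : 1 <= `|x| ->
  (`|x| * bracket x `^ s) ^+ 2 <=
    C * ((K * bracket x `^ s) * (K * bracket x `^ s)) ^+ 2 *
    (L * bracket x `^ (1 - beta)) ->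
  bracket x `^ (1 + beta - 2 * s) <= 4 * C * K ^+ 4 * L.
Proof.
move=> x1; have B0 := bracket_gt0 x.
set B := bracket x; set P := B `^ s; set Q := B `^ (1 - beta) => h.
have P0 : 0 < P by exact: powR_gt0.
have Q0 : 0 < Q by exact: powR_gt0.
have BE : B `^ (1 + beta - 2 * s) * (P ^+ 2 * Q) = B ^+ 2.
  have -> : P ^+ 2 = B `^ (s * 2%:R).
    by rewrite -powR_mulrn ?(ltW P0)// /P -powRrM.
  rewrite -[RHS]powR_mulrn ?(ltW B0)// /Q.
  by rewrite -!powRD ?(gt_eqF B0) ?implybT//; congr (_ `^ _); ring.
have PQ0 : 0 < P ^+ 2 * (P ^+ 2 * Q).
  by rewrite mulr_gt0 ?mulr_gt0 ?exprn_gt0.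
rewrite -(ler_pM2r PQ0).
rewrite (_ : B `^ _ * _ = P ^+ 2 * B ^+ 2); last by rewrite -BE; ring.
apply: (@le_trans _ _ (4 * (`|x| * P) ^+ 2)).
  have B2 : B ^+ 2 <= (2 * `|x|) ^+ 2.
    rewrite lerXn2r ?nnegrE ?(ltW B0) ?mulr_ge0//.
    by rewrite mulr_natl mulr2n lerD2r.
  apply: (le_trans (ler_wpM2l (ltW (exprn_gt0 2 P0)) B2)).
  by apply: eq_ler; ring.
apply: (le_trans (ler_wpM2l (ler0n _ 4) h)).
by apply: eq_ler; ring.
Qed.

(** Passing from denominators to frequencies: n / lambda is at most n in
    absolute value since lambda >= 1, and tends to infinity with n. *)
Lemma approximable_freq lambda d beta c M : 1 <= lambda -> 0 < c ->
  approximable d beta -> 0 <= beta ->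
  exists m n, let rho := m%:~R / n%:~R in let xi := freq lambda n in
    [/\ n != 0, 1 <= `|xi|, M <= `|xi|,
        `|rho - d| <= `|xi| `^ (- 2 - beta) & `|rho - d| <= c].
Proof.
move=> l1 c0 app b0; have l0 : 0 < lambda by exact: lt_le_trans l1.
have M0 : 0 <= 1 + `|M| by rewrite addr_ge0.
have lM : 0 <= lambda * (1 + `|M|) by rewrite mulr_ge0 ?(ltW l0).
have c10 : 0 <= c^-1 by rewrite invr_ge0 ltW.
(* |n| is large enough for |xi| >= 1 + |M| and for 1 / |n| <= c. *)
have [m [n [n0 nN mn]]] := app (Num.bound (lambda * (1 + `|M|) + c^-1)).
exists m, n => rho xi; rewrite -/rho distrC in mn.
have n1 := @normz_ge1 R n n0.
have n0R : 0 < `|n%:~R : R| by exact: lt_le_trans n1.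
have nbig : lambda * (1 + `|M|) + c^-1 <= `|n%:~R : R|.
  apply: (@le_trans _ _ (Num.bound (lambda * (1 + `|M|) + c^-1))%:R).
    by rewrite ltW// archi_boundP// addr_ge0.
  by rewrite -intr_norm -natr_absz ler_nat.
have xiE : `|xi| = `|n%:~R| / lambda.
  by rewrite /xi /freq normrM normfV (gtr0_norm l0).
have xiM : 1 + `|M| <= `|xi|.
  rewrite xiE ler_pdivlMr// mulrC; apply: le_trans nbig.
  by rewrite lerDl.
have xi1 : 1 <= `|xi| by apply: le_trans xiM; rewrite lerDl.
split=> //.
- by rewrite (le_trans (ler_norm M))// (le_trans _ xiM)// lerDr.
- apply: (le_trans mn).
  have b2 : 0 <= 2 + beta by rewrite addr_ge0.
  rewrite -opprD !powRN lef_pV2 ?posrE ?powR_gt0//; last exact: lt_le_trans xi1.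
  apply: ge0_ler_powR; rewrite ?nnegrE// xiE ler_pdivrMr// ler_peMr//.
- apply: (le_trans mn); apply: (@le_trans _ _ `|n%:~R : R|^-1).
    by rewrite -powR_inv1//; apply: ler_powR => //; lra.
  rewrite -[leRHS]invrK lef_pV2 ?posrE ?invr_gt0//.
  by apply: le_trans nbig; rewrite lerDr.
Qed.

Lemma not_wave_estimate_approximable lambda alpha s b beta d e :
  alpha < 1 -> 1 <= lambda -> d != 0 -> d != 1 ->
  (forall x1 x, x1 ^+ 3 + alpha * (x - x1) ^+ 3 - alpha * x ^+ 3 =
    (1 - alpha) * x1 * (x1 - d * x) * (x1 - e * x)) ->
  approximable d beta -> 0 <= beta -> beta <= 1 -> 2 * s - 1 < beta ->
  ~ wave_estimate lambda alpha s b (mean0 lambda).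
Proof.
move=> a1 l1 dn0 dn1 HE app b0 b1 sb.
have l0 : 0 < lambda by exact: lt_le_trans l1.
have a10 : 0 <= 1 - alpha by rewrite subr_ge0 ltW.
move=> /(wave_estimate_resonance l0)[C HC].
pose c := Num.min (Num.min `|d| `|1 - d| / 2) 1.
have c0 : 0 < c.
  rewrite lt_min ltr01 andbT divr_gt0//.
  by rewrite lt_min !normr_gt0 dn0 subr_eq0 eq_sym.
have [cd cd1 c1] : [/\ 2 * c <= `|d|, 2 * c <= `|1 - d| & c <= 1].
  have : 2 * c <= Num.min `|d| `|1 - d|.
    by rewrite mulrC -ler_pdivlMr// ge_min lexx.
  by rewrite le_min => /andP[? ?]; split => //; rewrite ge_min lexx orbT.
(* m / n is within c of d, so |m / n| and |1 - m / n| lie in [c, D]. *)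
pose D := `|d| + 2; pose K := (c / 2) `^ s + (D + 1) `^ s.
suff : 1 + beta - 2 * s <= 0 by lra.
apply: (@powR_bounded_exponent_le0 _
  (4 * `|C| * K ^+ 4 * (1 + (1 - alpha) * D * (D + `|e|)))) => M.
have [m [n []]] := approximable_freq M l1 c0 app b0.
set rho := m%:~R / n%:~R; set xi := freq lambda n => n0 xi1 xiM rd rc.
have [cr rD cr1 rD1] : [/\ c <= `|rho|, `|rho| <= D,
    c <= `|1 - rho| & `|1 - rho| <= D].
  have := ler_normB (rho - d) rho; have := ler_normD (rho - d) d.
  have := ler_normD (rho - d) (1 - rho); have := ler_normB 1 rho.
  rewrite (_ : rho - d - rho = - d) ?normrN; last by ring.
  rewrite (_ : rho - d + (1 - rho) = 1 - d) ?subrK ?normr1; last by ring.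
  clear -cd cd1 c1 rc; rewrite /D => *; split; lra.
have nR0 : n%:~R != 0 :> R by rewrite intr_eq0.
have xi1E : freq lambda m = rho * xi.
  by rewrite /xi /freq /rho; field; rewrite nR0 gt_eqF.
have xi2E : freq lambda (n - m) = (1 - rho) * xi.
  by rewrite mulrBl mul1r -xi1E /xi /freq intrB mulrBl.
have m0 : m != 0.
  by apply/eqP => mz; move: cr; rewrite /rho mz mul0r normr0 leNgt c0.
have := HC m (n - m) m0; rewrite /= addrCA subrr addr0 -/xi xi1E xi2E.
have -> : (1 - rho) * xi = xi - rho * xi by ring.
rewrite HE => h.
exists (bracket xi); first by rewrite (le_trans xiM)// lerDr.
apply: bracket_powR_bound => //; apply: (le_trans h).
have cmp1 := bracket_powR_scale_le s c0 xi1 cr rD.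
have cmp2 := bracket_powR_scale_le s c0 xi1 cr1 rD1.
rewrite mulrBl mul1r -/K in cmp1 cmp2.
apply: (@le_trans _ _ (`|C| *
    (bracket (rho * xi) `^ s * bracket (xi - rho * xi) `^ s) ^+ 2 *
    bracket ((1 - alpha) * (rho * xi) * (rho * xi - d * xi) *
      (rho * xi - e * xi)))).
  apply: ler_wpM2r; first exact: bracket_ge0.
  by apply: ler_wpM2r; [exact: sqr_ge0|exact: ler_norm].
apply: ler_pM.
- by rewrite mulr_ge0// sqr_ge0.
- exact: bracket_ge0.
- apply: ler_wpM2l => //.
  have BB := ler_pM (powR_ge0 _ _) (powR_ge0 _ _) cmp1 cmp2.
  by apply: lerXn2r BB; rewrite nnegrE !mulr_ge0 ?addr_ge0 ?powR_ge0.
- exact: bracket_resonance_le.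
Qed.

End Failure.

Theorem proposition3p10 (R : realType) (alpha lambda : R)
    (alpha_gt0 : 0 < alpha) (alpha_lt1 : alpha < 1) (lambda_ge1 : 1 <= lambda) :
  ((forall s b : R, ~ X_estimate lambda alpha s b setT) /\
   (forall s : R, ~ YZ_estimate lambda alpha s setT)) /\
  (forall s : R,
     (s%:E < mine 1 (2^-1%:E + 2^-1%:E *
               maxe (type_index (d1 alpha)) (type_index (d2 alpha))))%E ->
     (forall b : R, ~ X_estimate lambda alpha s b (mean0 lambda)) /\
     ~ YZ_estimate lambda alpha s (mean0 lambda)).
Proof.
have l0 : 0 < lambda by exact: lt_le_trans ltr01 lambda_ge1.
split; first split.
- by move=> s b /(X_estimate_wave l0); exact: not_wave_estimate_setT.
- by move=> s /(YZ_estimate_wave l0); exact: not_wave_estimate_setT.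
move=> s; rewrite lt_min lte_fin => /andP[s1 smax].
suff F b : ~ wave_estimate lambda alpha s b (mean0 lambda).
  split=> [b|]; first by move=> /(X_estimate_wave l0); exact: F.
  by move=> /(YZ_estimate_wave l0); exact: F.
have [d [dE /(approximable_type_index s1)[beta [b0 b1 sb app]]]] : exists d : R,
    (d = d1 alpha \/ d = d2 alpha) /\
    (s%:E < 2^-1%:E + 2^-1%:E * type_index d)%E.
  move: smax.
  case: (leP (type_index (d1 alpha)) (type_index (d2 alpha))) => _ h.
    by exists (d2 alpha); split => //; right.
  by exists (d1 alpha); split => //; left.
have [d0 d11] := resonance_root_neq alpha_gt0 alpha_lt1 dE.
case: dE => dE; subst d.
- apply: (not_wave_estimate_approximable alpha_lt1 lambda_ge1 d0 d11
    _ app b0 b1 sb) => x1 x.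
  exact: resonance_factor.
- apply: (not_wave_estimate_approximable alpha_lt1 lambda_ge1 d0 d11
    _ app b0 b1 sb) => x1 x.
  by rewrite resonance_factor// mulrAC.
Qed.
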